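(* Let $G$ be a graph with $\mathrm{mad}(G)<\frac{14}{5}$. Then for every set $\{x,y,z\}$ of three distinct vertices of $G$ that is non-blocked, $G$ is $(2,2,2)$-AT extendable with respect to $(x,y,z)$.
   Context: All graphs are finite and simple. $\mathrm{mad}(G)=\max_{H\subseteq G} 2|E(H)|/|V(H)|$ is the maximum average degree. For an orientation $D$ of a graph $G$, an Eulerian sub-digraph of $D$ is a spanning sub-digraph $F$ of $D$ with $d^+_F(v)=d^-_F(v)$ for every vertex $v$. Let $\mathrm{diff}(D)$ be the number of Eulerian sub-digraphs of $D$ with an even number of arcs minus the number with an odd number of arcs; $D$ is an AT-orientation if $\mathrm{diff}(D)\neq 0$. For $f:V(G)\to\mathbb{N}$, $G$ is $f$-AT if $G$ has an AT-orientation $D$ with $d^+_D(v)\le f(v)-1$ for every vertex $v$. Given distinct vertices $v_1,\dots,v_k$ and integers $a_i\in\{1,2\}$, define $f(v_i)=a_i$ for $i\in[k]$ and $f(v)=3$ for all other vertices; $G$ is $(a_1,\dots,a_k)$-AT extendable with respect to $(v_1,\dots,v_k)$ if $G$ is $f$-AT. A set $\{x,y,z\}$ of three distinct vertices of $G$ is blocked if either every proper $3$-coloring $\phi$ of $G$ satisfies $|\phi(\{x,y,z\})|=3$, or every proper $3$-coloring $\phi$ of $G$ satisfies $|\phi(\{x,y,z\})|=1$; it is non-blocked otherwise. (In particular, if $G$ has no proper 3-coloring, every triple is blocked.) *)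

(* Defs.v *)
From mathcomp Require Import all_boot all_order all_algebra.
Set Implicit Arguments. Unset Strict Implicit. Unset Printing Implicit Defensive.

Section Defs.
Variable T : finType.
(* A finite simple graph: vertex type T, symmetric irreflexive adjacency e. *)
Variable e : rel T.

Definition edges : {set {set T}} :=
  [set A : {set T} | [exists x, exists y, e x y && (A == [set x; y])]].

(* mad(G) < p/q : every (nonempty) subgraph H = (S, F) has 2|F|/|S| < p/q. *)
Definition mad_lt (p q : nat) : Prop :=
  forall (S : {set T}) (F : {set {set T}}),
    S != set0 -> F \subset edges -> (forall A, A \in F -> A \subset S) ->
    (2 * #|F|) * q < p * #|S|.

Definition is_orientation (d : rel T) : Prop :=
  forall x y, e x y = (d x y || d y x) /\ ~~ (d x y && d y x).

Definition arcs (d : rel T) : {set T * T} := [set p | d p.1 p.2].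

Definition outdegF (F : {set T * T}) (v : T) := #|[set p in F | p.1 == v]|.
Definition indegF (F : {set T * T}) (v : T) := #|[set p in F | p.2 == v]|.

(* Eulerian (spanning) sub-digraph of D, given by its arc set. *)
Definition eulerian (d : rel T) (F : {set T * T}) : bool :=
  (F \subset arcs d) && [forall v, outdegF F v == indegF F v].

Definition diffD (d : rel T) : int :=
  (#|[set F | eulerian d F & ~~ odd #|F|]|%:Z -
   #|[set F | eulerian d F & odd #|F|]|%:Z)%R.

Definition outdeg (d : rel T) (v : T) := #|[set y | d v y]|.

(* G is f-AT: AT-orientation with d^+(v) <= f(v) - 1, i.e. d^+(v) < f(v). *)
Definition f_AT (f : T -> nat) : Prop :=
  exists d : rel T, [/\ is_orientation d, diffD d != 0%R &
                        forall v, outdeg d v < f v].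

Definition AT_extendable (vs : seq T) (a : seq nat) : Prop :=
  f_AT (fun v => if v \in vs then nth 3 a (index v vs) else 3).

Definition proper3 (phi : T -> 'I_3) : Prop :=
  forall x y, e x y -> phi x != phi y.

Definition blocked (x y z : T) : Prop :=
  (forall phi, proper3 phi -> #|phi @: [set x; y; z]| = 3) \/
  (forall phi, proper3 phi -> #|phi @: [set x; y; z]| = 1).

End Defs.

(* Main.v *)
Require Import Defs.
From mathcomp Require Import all_boot all_order all_algebra.
From mathcomp Require Import zify.

Set Implicit Arguments. Unset Strict Implicit. Unset Printing Implicit Defensive.
Import Order.TTheory GRing.Theory.

(* Let f be 2 on x, y, z and 3 elsewhere. By induction every induced subgraph
   G[S] is f-AT. A vertex of degree below f is added last as a source, so assume
   deg >= f on S. The bound 5|E| < 7|V| then leaves two cases.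
   (i) deg = f on S. The end of a longest path shows that G[S] has an even cycle,
   unless it contains the triangle xyz, which would force all 3-colourings to be
   rainbow. A shortest even cycle has at most one chord (K4 is too dense), so it
   has an AT-orientation with an in-arc at every vertex; this extends to its
   component by adding vertices as sinks.
   (ii) x, y, z are in S, the total surplus of deg - f is 1 and |S| is 4, 6 or 8.
   These finitely many graphs are enumerated: each one either forces x, y, z to
   be rainbow or has an explicit AT-orientation. *)

(** * Signed counts of Eulerian sub-digraphs *)

(** The obstacle is that [diffD] is a signed count, which may cancel when orientations are combined.
    All gluing is therefore done along directed cuts: no Eulerian sub-digraph uses an arc that
    crosses a cut in one direction only, so the two counts multiply. Adding a source, adding a sink
    and uniting components are all instances of this.

    When every degree equals [f] there is nothing to spare, so each vertex needs an in-arc. An even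
    cycle with at most one chord serves as a seed: oriented cyclically, its Eulerian sub-digraphs
    are the empty one, the cycle, and at most one more through the chord. The first two both count
    +1, so the third cannot cancel them.

    The colouring condition enters through a single proper 3-colouring that is not rainbow on x, y,
    z. It is fixed for the whole induction, because it restricts to every induced subgraph; it
    refutes both the triangle in case (i) and the rainbow outcome in case (ii). *)

Lemma cardsU_disjoint (I : finType) (A B : {set I}) :
  (forall x, x \in A -> x \notin B) -> #|A :|: B| = #|A| + #|B|.
Proof.
move=> dAB; rewrite -cardsUI (_ : A :&: B = set0) ?cards0 ?addn0 //.
by apply/setP=> x; rewrite !inE; apply/negP=> /andP[/dAB/negP].
Qed.

Section SignedCount.
Variable T : finType.
Implicit Types (A B F : {set T * T}) (o i : T -> nat).

Definition balanced F o i := [forall v, o v + outdegF F v == i v + indegF F v].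

(* With zero offsets and A the arc set of D this is diff(D); the offsets
   record the arcs already committed to the sub-digraph. *)
Definition wdiff A o i : int :=
  (\sum_(F : {set T * T} | (F \subset A) && balanced F o i) (-1) ^+ #|F|)%R.

Lemma eq_wdiff A o i o' i' :
  (forall v, o v + i' v = o' v + i v) -> wdiff A o i = wdiff A o' i'.
Proof.
move=> H; apply: eq_bigl => F; congr andb.
by apply: eq_forallb => v; have := H v; lia.
Qed.

Lemma outdegFU1 p A v : p \notin A -> outdegF (p |: A) v = (p.1 == v) + outdegF A v.
Proof.
move=> pA; rewrite /outdegF.
have -> : [set q in p |: A | q.1 == v]
    = if p.1 == v then p |: [set q in A | q.1 == v] else [set q in A | q.1 == v].
  by apply/setP=> q; case: ifP => pv; rewrite !inE; case: eqVneq => //= ->;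
     rewrite pv ?(negPf pA).
by case: ifP => //=; rewrite cardsU1 inE (negPf pA).
Qed.

Lemma indegFU1 p A v : p \notin A -> indegF (p |: A) v = (p.2 == v) + indegF A v.
Proof.
move=> pA; rewrite /indegF.
have -> : [set q in p |: A | q.2 == v]
    = if p.2 == v then p |: [set q in A | q.2 == v] else [set q in A | q.2 == v].
  by apply/setP=> q; case: ifP => pv; rewrite !inE; case: eqVneq => //= ->;
     rewrite pv ?(negPf pA).
by case: ifP => //=; rewrite cardsU1 inE (negPf pA).
Qed.

Lemma wdiff0 o i : wdiff set0 o i = [forall v, o v == i v]%:R%R.
Proof.
rewrite /wdiff (bigID (pred1 set0)) /= [X in (_ + X)%R]big1 ?addr0; last first.
  by move=> F; rewrite subset0 => /andP[/andP[->]].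
under eq_bigl => F do rewrite subset0 andbAC andbb.
have deg0 v : (outdegF set0 v = 0) * (indegF set0 v = 0).
  by rewrite /outdegF /indegF; split; apply/eqP; rewrite cards_eq0;
     apply/eqP/setP=> q; rewrite !inE.
have -> : [forall v, o v == i v] = balanced set0 o i.
  by apply: eq_forallb => v; rewrite !deg0 !addn0.
by rewrite big_mkcondr big_pred1_eq; case: ifP => //=; rewrite cards0 expr0.
Qed.

(** Sub-digraphs avoiding [p] give the first term. Those containing [p] correspond to sub-digraphs
    of [A] once [p] is moved into the offsets, at the price of one sign. *)
Lemma wdiffU1 p A o i : p \notin A ->
  wdiff (p |: A) o i
  = (wdiff A o i - wdiff A (fun v => o v + (p.1 == v))%N (fun v => i v + (p.2 == v))%N)%R.
Proof.
move=> pA; rewrite /wdiff (bigID (fun F => p \notin F)) /=; congr (_ + _)%R.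
  apply: eq_bigl => F; rewrite -andbA [_ && (_ \notin _)]andbC andbA; congr andb.
  apply/andP/idP=> [[/subsetP sF pF]|sF].
    apply/subsetP=> q qF; have := sF q qF; rewrite !inE => /orP[/eqP qp|//].
    by rewrite -qp qF in pF.
  split; first by apply: subset_trans sF (subsetUr _ _).
  by apply: contra pA; apply: (subsetP sF).
rewrite -sumrN (reindex_onto (fun F => p |: F) (fun F => F :\ p)) /=; last first.
  by move=> F; rewrite negbK => /andP[_ pF]; rewrite setD1K.
apply: eq_big => [F|F /andP[_ /eqP FE]]; last first.
  by rewrite cardsU1 -FE !inE eqxx /= exprS mulN1r.
rewrite !inE eqxx /= andbT.
have [pF|pF] := boolP (p \in F).
  have -> : ((p |: F) :\ p == F) = false.
    by apply/negbTE/eqP=> /setP/(_ p); rewrite !inE eqxx pF.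
  rewrite andbF; apply/esym/negbTE; rewrite negb_and.
  by apply/orP; left; apply: contra pA => /subsetP; apply.
rewrite setU1K // eqxx andbT; congr andb.
  apply/idP/idP=> [/subsetP sF|]; last exact: setUS.
  apply/subsetP=> q qF; have := sF q; rewrite !inE qF orbT => /(_ isT)/orP[/eqP qp|//].
  by rewrite -qp qF in pF.
by apply: eq_forallb => v; rewrite outdegFU1 // indegFU1 // !addnA.
Qed.

(** No arc of [A] can repair the imbalance at [v]. This kills the mixed terms in the series
    reduction and justifies the cut in the counting program. *)
Lemma wdiff_unbalanced A o i v :
  (forall p, p \in A -> p.1 != v /\ p.2 != v) -> o v != i v -> wdiff A o i = 0%R.
Proof.
move=> Av oiv; rewrite /wdiff big1 // => F /andP[/subsetP sF /forallP/(_ v)].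
have -> : outdegF F v = 0.
  apply/eqP; rewrite cards_eq0; apply/eqP/setP=> q; rewrite !inE.
  by apply/negP=> /andP[/sF/Av[/negP]].
have -> : indegF F v = 0.
  apply/eqP; rewrite cards_eq0; apply/eqP/setP=> q; rewrite !inE.
  by apply/negP=> /andP[/sF/Av[_ /negP]].
by rewrite !addn0 (negPf oiv).
Qed.

Lemma diffD_wdiff (d : rel T) :
  diffD d = wdiff (arcs d) (fun=> 0%N) (fun=> 0%N).
Proof.
rewrite /wdiff (bigID (fun F => ~~ odd #|F|)) /= /diffD.
have E F : (F \subset arcs d) && balanced F (fun=> 0%N) (fun=> 0%N) = eulerian d F.
  by congr andb; apply: eq_forallb.
rewrite -!natz -!sum1_card !natr_sum; congr (_ + _)%R.
  apply: eq_big => F; rewrite inE; first by rewrite E.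
  by case/andP=> _; rewrite -signr_odd => /negPf ->.
rewrite -sumrN; apply: eq_big => F; rewrite inE; first by rewrite E negbK.
by case/andP=> _; rewrite -signr_odd => ->.
Qed.

Lemma outdegFU A B v : [disjoint A & B] -> outdegF (A :|: B) v = outdegF A v + outdegF B v.
Proof.
move=> dAB; rewrite /outdegF -cardsU_disjoint; last first.
  by move=> q; rewrite !inE => /andP[/(disjointFr dAB) -> _].
by congr #|pred_of_set _|; apply/setP=> q; rewrite !inE andb_orl.
Qed.

Lemma indegFU A B v : [disjoint A & B] -> indegF (A :|: B) v = indegF A v + indegF B v.
Proof.
move=> dAB; rewrite /indegF -cardsU_disjoint; last first.
  by move=> q; rewrite !inE => /andP[/(disjointFr dAB) -> _].
by congr #|pred_of_set _|; apply/setP=> q; rewrite !inE andb_orl.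
Qed.

Definition incident_in (X : {set T}) A := forall p, p \in A -> p.1 \in X /\ p.2 \in X.

Lemma outdegF_out X A v : incident_in X A -> v \notin X -> outdegF A v = 0.
Proof.
move=> AX vX; apply/eqP; rewrite cards_eq0; apply/eqP/setP=> q; rewrite !inE.
by apply/negP=> /andP[/AX[qX _] /eqP qv]; rewrite -qv qX in vX.
Qed.

Lemma indegF_out X A v : incident_in X A -> v \notin X -> indegF A v = 0.
Proof.
move=> AX vX; apply/eqP; rewrite cards_eq0; apply/eqP/setP=> q; rewrite !inE.
by apply/negP=> /andP[/AX[_ qX] /eqP qv]; rewrite -qv qX in vX.
Qed.

(** A subset of the union is a pair of subsets, signs multiply, and since each vertex meets arcs of
    one part only, balance can be tested on the two parts separately. *)
Lemma wdiffM (X Y : {set T}) A B : [disjoint X & Y] -> incident_in X A -> incident_in Y B ->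
  wdiff (A :|: B) (fun=> 0%N) (fun=> 0%N)
  = (wdiff A (fun=> 0%N) (fun=> 0%N) * wdiff B (fun=> 0%N) (fun=> 0%N))%R.
Proof.
move=> dXY AX BY.
have subX F : F \subset A -> incident_in X F by move=> /subsetP sF p /sF/AX.
have subY F : F \subset B -> incident_in Y F by move=> /subsetP sF p /sF/BY.
have dAB : [disjoint A & B].
  rewrite -setI_eq0; apply/eqP/setP=> p; rewrite !inE; apply/negP=> /andP[/AX[pX _] /BY[pY _]].
  by have := disjointFr dXY pX; rewrite pY.
rewrite /wdiff big_distrlr /= pair_big /=.
rewrite (reindex_onto (fun FG : {set T * T} * {set T * T} => FG.1 :|: FG.2)
           (fun F => (F :&: A, F :&: B))) /=; last first.
  by move=> F /andP[sF _]; rewrite -setIUr; apply/setIidPl.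
apply: eq_big => [[F G]|[F G]] /=; last first.
  move=> /andP[_ /eqP[FE GE]]; rewrite -exprD cardsU_disjoint // => p.
  by rewrite -FE -GE !inE => /andP[_ pA]; rewrite (disjointFr dAB pA) andbF.
have [sF|sF] := boolP (F \subset A); last first.
  apply/negbTE; apply: contra sF => /andP[_ /eqP[<- _]]; exact: subsetIr.
have [sG|sG] := boolP (G \subset B); last first.
  rewrite andbF; apply/negbTE; apply: contra sG => /andP[_ /eqP[_ <-]]; exact: subsetIr.
have -> : (F :|: G) :&: A = F.
  rewrite setIUl (setIidPl sF) (_ : G :&: A = set0) ?setU0 //.
  by apply/eqP; rewrite setI_eq0 disjoint_sym; apply: disjointWr sG dAB.
have -> : (F :|: G) :&: B = G.
  rewrite setIUl (setIidPl sG) (_ : F :&: B = set0) ?set0U //.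
  by apply/eqP; rewrite setI_eq0; apply: disjointWl sF dAB.
rewrite eqxx andbT setUSS //=.
have dFG : [disjoint F & G] := disjointWl sF (disjointWr sG dAB).
apply/forallP/andP=> [H|[/forallP HF /forallP HG] v]; last first.
  have := HF v; have := HG v; rewrite !add0n outdegFU // indegFU //.
  by move=> /eqP -> /eqP ->.
split; apply/forallP=> v; have := H v; rewrite !add0n outdegFU // indegFU //.
  have [vX|vX] := boolP (v \in X).
    by rewrite !(outdegF_out (subY _ sG)) ?(indegF_out (subY _ sG)) ?(disjointFr dXY) ?addn0.
  by rewrite (outdegF_out (subX _ sF)) // (indegF_out (subX _ sF)).
have [vY|vY] := boolP (v \in Y).
  by rewrite (outdegF_out (subX _ sF)) ?(indegF_out (subX _ sF)) // ?(disjointFl dXY) // !add0n.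
by rewrite (outdegF_out (subY _ sG)) // (indegF_out (subY _ sG)).
Qed.

(** Summing the balance over [X], as many arcs of [F] start in [X] as end in it. No arc leaves [X],
    so the first set of arcs lies in the second, and equal size makes them equal. *)
Lemma eulerian_cut (X : {set T}) (d : rel T) F :
  eulerian d F -> (forall u v, u \in X -> v \notin X -> ~~ d u v) ->
  forall p, p \in F -> (p.1 \in X) = (p.2 \in X).
Proof.
move=> /andP[/subsetP sF /forallP eF] cut.
have sum_out : \sum_(v in X) outdegF F v = #|[set p in F | p.1 \in X]|.
  rewrite -sum1_card; under [RHS]eq_bigl do rewrite inE.
  rewrite (partition_big (fun p : T * T => p.1) (mem X)) /=; last by move=> p /andP[].
  apply: eq_bigr => v vX; rewrite /outdegF -sum1_card; apply: eq_bigl => p; rewrite !inE.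
  by rewrite -andbA; congr andb; apply/idP/andP=> [/eqP ->|[]].
have sum_in : \sum_(v in X) indegF F v = #|[set p in F | p.2 \in X]|.
  rewrite -sum1_card; under [RHS]eq_bigl do rewrite inE.
  rewrite (partition_big (fun p : T * T => p.2) (mem X)) /=; last by move=> p /andP[].
  apply: eq_bigr => v vX; rewrite /indegF -sum1_card; apply: eq_bigl => p; rewrite !inE.
  by rewrite -andbA; congr andb; apply/idP/andP=> [/eqP ->|[]].
have sub : [set p in F | p.1 \in X] \subset [set p in F | p.2 \in X].
  apply/subsetP=> p; rewrite !inE => /andP[pF pX]; rewrite pF /=.
  apply: contraT => pX2; have := cut _ _ pX pX2; have := sF p pF.
  by rewrite inE => ->.
have /setP eqs : [set p in F | p.1 \in X] = [set p in F | p.2 \in X].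
  apply/eqP; rewrite eqEcard sub /= -sum_out -sum_in.
  by under eq_bigr => v _ do rewrite -(eqP (eF v)).
by move=> p pF; have := eqs p; rewrite !inE pF.
Qed.

End SignedCount.

(** * Orientations of induced subgraphs *)

Section Induced.
Variable T : finType.
Variable e : rel T.
Hypothesis e_sym : symmetric e.
Hypothesis e_irr : irreflexive e.
Implicit Types (B S X Y : {set T}) (f g : T -> nat).

Definition induced S : rel T := fun u v => [&& e u v, u \in S & v \in S].

(** The orientation lives on all of [T], without arcs outside [S], so that orientations of disjoint
    vertex sets are united as relations on one type. *)
Definition AT_on S f := exists d : rel T,
  [/\ is_orientation (induced S) d, diffD d != 0%R &
      forall v, v \in S -> outdeg d v < f v].

Definition degS S v := #|[set u in S | e v u]|.

Lemma orientation_sub S d u v : is_orientation (induced S) d -> d u v -> induced S u v.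
Proof. by move=> od duv; rewrite (od u v).1 duv. Qed.

Lemma AT_on_leq S f g : AT_on S f -> (forall v, v \in S -> f v <= g v) -> AT_on S g.
Proof.
move=> [d [od nz df]] fg; exists d; split=> // v vS; exact: leq_trans (df v vS) (fg v vS).
Qed.

Lemma AT_on0 f : AT_on set0 f.
Proof.
exists (fun _ _ => false); split=> [u v||v]; rewrite ?inE //.
  by rewrite /induced !inE !andbF.
rewrite diffD_wdiff (_ : arcs _ = set0); last by apply/setP=> p; rewrite !inE.
by rewrite wdiff0; case: forallP => // -[] v.
Qed.

Lemma AT_on1 v f : 0 < f v -> AT_on [set v] f.
Proof.
move=> fv; exists (fun _ _ => false); split=> [u w||w].
- rewrite /induced !inE; split=> //; apply/negP=> /and3P[euw /eqP ue /eqP we].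
  by rewrite ue we e_irr in euw.
- rewrite diffD_wdiff (_ : arcs _ = set0); last by apply/setP=> p; rewrite !inE.
  by rewrite wdiff0; case: forallP => // -[] w.
- rewrite inE => /eqP ->; by rewrite /outdeg (_ : [set _ | _] = set0) ?cards0.
Qed.

(** All cross edges are directed from [Y] to [X]. By [eulerian_cut] they lie in no Eulerian
    sub-digraph, so the signed count is the product of two nonzero ones. Only vertices of [Y] pay,
    one unit of out-degree per neighbour in [X]. *)
Lemma AT_onU X Y f g : [disjoint X & Y] -> AT_on X f -> AT_on Y g ->
  (forall v, v \in Y -> g v + degS X v <= f v) -> AT_on (X :|: Y) f.
Proof.
move=> dXY [d1 [o1 nz1 f1]] [d2 [o2 nz2 f2]] gf.
have XY u : u \in X -> u \in Y -> False by move=> uX; rewrite (disjointFr dXY uX).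
pose cross u v := [&& e u v, u \in Y & v \in X].
have I1 u v : d1 u v -> [/\ e u v, u \in X & v \in X].
  by move=> /(orientation_sub o1)/and3P[].
have I2 u v : d2 u v -> [/\ e u v, u \in Y & v \in Y].
  by move=> /(orientation_sub o2)/and3P[].
have N1u u v : u \in Y -> d1 u v = false by move=> uY; apply/negP=> /I1[_ /XY].
have N1v u v : v \in Y -> d1 u v = false by move=> uY; apply/negP=> /I1[_ _ /XY].
have N2u u v : u \in X -> d2 u v = false by move=> uY; apply/negP=> /I2[_ /(XY _ uY)].
have N2v u v : v \in X -> d2 u v = false by move=> uY; apply/negP=> /I2[_ _ /(XY _ uY)].
pose d u v := [|| d1 u v, d2 u v | cross u v].
exists d; split.
- move=> u v; have [E1 A1] := o1 u v; have [E2 A2] := o2 u v.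
  move: E1 E2 A1 A2; rewrite /d /cross /induced !inE (e_sym v u).
  have [uX|uX] := boolP (u \in X); have [vX|vX] := boolP (v \in X);
  have [uY|uY] := boolP (u \in Y); have [vY|vY] := boolP (v \in Y) => //=;
  rewrite ?andbT ?andbF ?orbF ?orbT //=;
  try (by case: (XY _ uX uY)); try (by case: (XY _ vX vY));
  by case: (e u v); case: (d1 u v); case: (d1 v u); case: (d2 u v); case: (d2 v u).
- rewrite diffD_wdiff.
  have -> : wdiff (arcs d) (fun=> 0%N) (fun=> 0%N)
      = wdiff (arcs d1 :|: arcs d2) (fun=> 0%N) (fun=> 0%N).
    apply: eq_bigl => F.
    have EF (d' : rel T) : (F \subset arcs d') && balanced F (fun=> 0%N) (fun=> 0%N) = eulerian d' F.
      by congr andb; apply: eq_forallb.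
    have -> : arcs d1 :|: arcs d2 = arcs (fun u v => d1 u v || d2 u v).
      by apply/setP=> p; rewrite !inE.
    rewrite !EF; apply/idP/idP=> /andP[sF bF]; apply/andP; split=> //.
      have cut u v : u \in X -> v \notin X -> ~~ d u v.
        move=> uX vX; apply/negP=> /or3P[/I1[]|/I2[_ /(XY _ uX)]|/and3P[_ /(XY _ uX)]] //.
        by rewrite (negPf vX).
      have EuF : eulerian d F by apply/andP.
      apply/subsetP=> p pF; have := eulerian_cut EuF cut pF.
      have := subsetP sF p pF; rewrite !inE => /or3P[->|->|/and3P[_ pY ->]] //; rewrite ?orbT //.
      by move=> pX; case: (XY _ pX pY).
    apply: subset_trans sF _; apply/subsetP=> p; rewrite !inE /d.
    by case/orP=> -> //; rewrite orbT.
  rewrite (wdiffM dXY) -?diffD_wdiff ?mulf_neq0 //.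
    by move=> p; rewrite inE => /I1[].
  by move=> p; rewrite inE => /I2[].
- move=> v; rewrite inE => /orP[vX|vY].
    rewrite /outdeg (_ : [set _ | _] = [set y | d1 v y]) ?f1 //.
    apply/setP=> y; rewrite !inE /d N2u //=; case: (d1 v y) => //=.
    by apply/negP=> /and3P[_ /(XY _ vX)].
  rewrite (leq_trans _ (gf v vY)) //.
  have -> : outdeg d v = outdeg d2 v + degS X v.
    rewrite /outdeg /degS -cardsU_disjoint; last first.
      by move=> y; rewrite !inE; apply: contraTN => /andP[yX _]; rewrite N2v.
    congr #|pred_of_set _|; apply/setP=> y.
    rewrite !inE /d N1u //= /cross vY /=; congr orb; exact: andbC.
  by rewrite ltn_add2r f2.
Qed.

Lemma AT_on_rem S f v : v \in S -> degS S v < f v -> AT_on (S :\ v) f -> AT_on S f.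
Proof.
move=> vS dv ATS; rewrite -(setD1K vS) setUC.
have := @AT_onU (S :\ v) [set v] f (fun=> 1); apply.
- by rewrite disjoint_sym disjoints1 !inE eqxx.
- by [].
- exact: AT_on1.
- move=> u; rewrite inE => /eqP ->; rewrite add1n; apply: leq_ltn_trans dv.
  by apply: subset_leq_card; apply/subsetP=> w; rewrite !inE => /andP[/andP[_ ->]].
Qed.

(* Adding v as a sink costs each of its neighbours one unit of out-degree. *)
Lemma AT_on_deg_add B v : v \notin B -> 0 < degS B v ->
  AT_on B (degS B) -> AT_on (v |: B) (degS (v |: B)).
Proof.
move=> vB dv ATB.
have := @AT_onU [set v] B (degS (v |: B)) (degS B); apply=> //.
- by rewrite disjoints1.
- apply: AT_on1; apply: leq_trans dv _.
  by apply: subset_leq_card; apply/subsetP=> w; rewrite !inE => /andP[-> ->]; rewrite orbT.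
- move=> u uB; rewrite /degS addnC -cardsU_disjoint; last first.
    by move=> w; rewrite !inE => /andP[/eqP -> _]; rewrite (negPf vB).
  apply: subset_leq_card; apply/subsetP=> w; rewrite !inE.
  by case/orP=> /andP[-> ->]; rewrite ?orbT.
Qed.

(** Vertices of [S] with a neighbour in the current set are added one at a time as sinks. When none
    is left the set is a union of components of the subgraph induced by [S]. *)
Lemma AT_on_deg_closure S B : B \subset S -> B != set0 -> AT_on B (degS B) ->
  exists C : {set T}, [/\ C \subset S, C != set0, AT_on C (degS C) &
                forall u v, u \in C -> v \in S :\: C -> ~~ e v u].
Proof.
have [k] := ubnP #|S :\: B|; elim: k B => // k IH B.
rewrite ltnS => kB BS B0 ATB.
have [/existsP[v /andP[vSB dv]]|/existsPn nv] :=
  boolP [exists v, (v \in S :\: B) && (0 < degS B v)].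
  have [vB vS] : v \notin B /\ v \in S by move: vSB; rewrite inE => /andP[].
  apply: (IH (v |: B)).
  - apply: leq_trans kB; apply: proper_card; apply/properP; split.
      by apply/subsetP=> w; rewrite !inE negb_or => /andP[/andP[_ ->] ->].
    by exists v; rewrite ?vSB // !inE eqxx.
  - by rewrite subUset sub1set vS.
  - by apply/set0Pn; exists v; rewrite !inE eqxx.
  - exact: AT_on_deg_add.
exists B; split=> // u v uB vSB; have := nv v; rewrite vSB /= -eqn0Ngt cards_eq0.
by move=> /eqP/setP/(_ u); rewrite !inE uB /= => ->.
Qed.

End Induced.

(** * Even cycles with at most one chord *)

Section PathArcs.
Variable T : finType.
Implicit Types (a b c u v : T) (p q s : seq T) (A : {set T * T}).

Fixpoint parcs a s : seq (T * T) := if s is b :: s' then (a, b) :: parcs b s' else [::].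

Lemma parcs_cat a s1 s2 : parcs a (s1 ++ s2) = parcs a s1 ++ parcs (last a s1) s2.
Proof. by elim: s1 a => //= b s1 IH a; rewrite IH. Qed.

Lemma parcs_rcons a s b : parcs a (rcons s b) = rcons (parcs a s) (last a s, b).
Proof. by rewrite -cats1 parcs_cat cats1. Qed.

Lemma parcs_consec a s1 u v s2 : (u, v) \in parcs a (s1 ++ u :: v :: s2).
Proof. by rewrite parcs_cat mem_cat /= !inE eqxx !orbT. Qed.

Lemma parcs_mem a s u v : (u, v) \in parcs a s -> u \in belast a s /\ v \in s.
Proof.
elim: s a => //= b s IH a; rewrite !inE => /orP[/eqP[-> ->]|/IH[-> ->]].
  by rewrite !eqxx.
by rewrite !orbT.
Qed.

Lemma parcs_path (r : rel T) a s u v : path r a s -> (u, v) \in parcs a s -> r u v.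
Proof.
elim: s a => //= b s IH a /andP[rab pth]; rewrite inE => /orP[/eqP[-> ->] //|].
exact: IH pth.
Qed.

Lemma parcs_in_r a s v : v \in s -> exists u, (u, v) \in parcs a s.
Proof.
elim: s a => //= b s IH a; rewrite inE => /orP[/eqP ->|/(IH b)[u uv]].
  by exists a; rewrite inE eqxx.
by exists u; rewrite inE uv orbT.
Qed.

Lemma parcs_fun a s u v w : uniq (belast a s) ->
  (u, v) \in parcs a s -> (u, w) \in parcs a s -> v = w.
Proof.
elim: s a => //= b s IH a /andP[ab us]; rewrite !inE.
case/orP=> [/eqP[ua ->]|uv]; case/orP=> [/eqP[ua' ->]|uw] //.
- by have [] := parcs_mem uw; rewrite ua (negPf ab).
- by have [] := parcs_mem uv; rewrite ua' (negPf ab).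
- exact: IH us uv uw.
Qed.

Definition carcs s := if s is a :: s' then parcs a (rcons s' a) else [::].

Lemma carcs_split a p b q :
  carcs (a :: p ++ b :: q) = parcs a (rcons p b) ++ parcs b (rcons q a).
Proof. by rewrite /= rcons_cat rcons_cons -cat_rcons parcs_cat last_rcons. Qed.

Lemma carcs_consec a p1 u v p2 b q : (u, v) \in carcs (a :: (p1 ++ u :: v :: p2) ++ b :: q).
Proof. by rewrite carcs_split rcons_cat mem_cat parcs_consec. Qed.

Lemma carcs_catC s1 s2 x : (x \in carcs (s1 ++ s2)) = (x \in carcs (s2 ++ s1)).
Proof.
case: s1 s2 => [|a p] [|b q]; rewrite ?cats0 //.
by rewrite !cat_cons !carcs_split !mem_cat orbC.
Qed.

(* Series reduction: a directed path with fresh internal vertices is taken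
   entirely or not at all. *)
Lemma wdiff_path a p b A o i :
  uniq p -> a \notin p -> b \notin p -> (p = [::] -> (a, b) \notin A) ->
  (forall x, x \in A -> x.1 \notin p /\ x.2 \notin p) ->
  (forall c, c \in p -> o c = i c) ->
  wdiff ([set x in parcs a (rcons p b)] :|: A) o i
  = (wdiff A o i + (-1) ^+ (size p).+1
     * wdiff A (fun v => o v + (a == v))%N (fun v => i v + (b == v))%N)%R.
Proof.
elim: p a o i => [|c p IH] a o i.
  move=> _ _ _ abA _ _; rewrite /= expr1 mulN1r.
  rewrite (_ : _ :|: A = (a, b) |: A) ?wdiffU1 ?abA //.
  by apply/setP=> x; rewrite !inE.
move=> /andP[cp up]; rewrite !inE !negb_or => /andP[ac ap] /andP[bc bp] _ fresh oi.
have freshp x : x \in A -> x.1 \notin p /\ x.2 \notin p.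
  by move=> /fresh[]; rewrite !inE !negb_or => /andP[_ ->] /andP[_ ->].
have freshc x : x \in A -> x.1 != c /\ x.2 != c.
  by move=> /fresh[]; rewrite !inE !negb_or => /andP[-> _] /andP[-> _].
have cbA : p = [::] -> (c, b) \notin A.
  by move=> _; apply/negP=> /freshc[/eqP].
have oip v : v \in p -> o v = i v by move=> vp; rewrite oi ?inE ?vp ?orbT.
have -> : [set x in parcs a (rcons (c :: p) b)] :|: A
    = (a, c) |: ([set x in parcs c (rcons p b)] :|: A).
  by apply/setP=> x; rewrite !inE orbA.
rewrite wdiffU1; last first.
  rewrite !inE negb_or; apply/andP; split.
    apply/negP=> /parcs_mem[_]; rewrite mem_rcons inE (negPf cp) orbF.
    by rewrite eq_sym (negPf bc).
  by apply/negP=> /freshc[_ /eqP].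
have oc : o c = i c by apply: oi; rewrite inE eqxx.
rewrite !IH //; last first.
  move=> v vp /=; rewrite oip //; congr addn.
  have -> : (a == v) = false by apply: contraNF ap => /eqP ->.
  by have -> : (c == v) = false by apply: contraNF cp => /eqP ->.
(* The first arc and the rest of the path are each taken or not. The two mixed choices leave the
   fresh vertex [c] unbalanced and vanish. *)
rewrite [X in (_ + _ * X - _)%R](@wdiff_unbalanced _ _ _ _ c) //; last first.
  by rewrite /= oc eqxx (negPf bc); lia.
rewrite [X in (_ - (X + _))%R](@wdiff_unbalanced _ _ _ _ c) //; last first.
  by rewrite /= oc eqxx (negPf ac); lia.
rewrite mulr0 addr0 add0r; congr (_ + _)%R.
rewrite -mulNr -mulN1r -exprS /=; congr (_ * _)%R.
by apply: eq_wdiff => v; rewrite -!addnA; do 2!congr (_ + _); rewrite addnCA.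
Qed.

End PathArcs.

(** * The AT-orientation of an even cycle with at most one chord *)

Section EvenCycle.
Variable T : finType.
Variable e : rel T.
Hypothesis e_sym : symmetric e.
Hypothesis e_irr : irreflexive e.
Implicit Types (a b c u v : T) (p q s : seq T) (S : {set T}).

Lemma carcs_mem s u v : (u, v) \in carcs s -> u \in s /\ v \in s.
Proof.
case: s => // a s /parcs_mem[]; rewrite belast_rcons mem_rcons.
by split.
Qed.

Lemma carcs_adj s u v : cycle e s -> (u, v) \in carcs s -> e u v.
Proof. by case: s => // a s; apply: parcs_path. Qed.

Lemma carcs_fun s u v w : uniq s -> (u, v) \in carcs s -> (u, w) \in carcs s -> v = w.
Proof. by case: s => // a s us; apply: parcs_fun; rewrite belast_rcons. Qed.

Lemma carcs_asym s u v : uniq s -> 2 < size s -> (u, v) \in carcs s -> (v, u) \notin carcs s.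
Proof.
move=> us sz uv; have [/splitPr us1 _] := carcs_mem uv.
case: us1 us sz uv => s1 s2 us sz; rewrite !(carcs_catC s1).
have {us} : uniq ((u :: s2) ++ s1) by rewrite uniq_catC.
have {sz} : 2 < size ((u :: s2) ++ s1) by move: sz; rewrite !size_cat /=; lia.
rewrite cat_cons; case: (s2 ++ s1) => [|v' [|w t]] // _ ut uv.
have uv' : (u, v') \in carcs [:: u, v', w & t] by rewrite inE eqxx.
have vw : (v', w) \in carcs [:: u, v', w & t] by rewrite !inE eqxx orbT.
rewrite (carcs_fun ut uv uv'); apply/negP=> vu.
have := carcs_fun ut vw vu => wu.
by move: ut; rewrite wu /= !inE eqxx orbT.
Qed.

(** The cycle is oriented cyclically and the possible chord from [a] to [b]. The empty sub-digraph
    and the even cycle contribute 2; the chord together with the path from [b] back to [a]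
    contributes 1 or -1 if the chord is present. The total is 1, 2 or 3. The cycle gives each vertex
    an in-arc, so out-degrees stay below degrees. *)
Lemma cycle_AT a p b q :
  uniq (a :: p ++ b :: q) -> cycle e (a :: p ++ b :: q) ->
  p != [::] -> q != [::] -> ~~ odd (size (a :: p ++ b :: q)) ->
  (forall u v, u \in a :: p ++ b :: q -> v \in a :: p ++ b :: q -> e u v ->
     [|| (u, v) \in carcs (a :: p ++ b :: q), (v, u) \in carcs (a :: p ++ b :: q),
         (u == a) && (v == b) | (u == b) && (v == a)]) ->
  let C := [set x in a :: p ++ b :: q] in AT_on e C (degS e C).
Proof.
set c := a :: p ++ b :: q => uc cyc p0 q0 ec chords C.
have [ab ap aq] : [/\ a != b, a \notin p & a \notin q].
  by move: uc; rewrite /c /= mem_cat inE !negb_or => /andP[/and3P[]].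
have [bp bq] : b \notin p /\ b \notin q.
  move: uc; rewrite /c /= cat_uniq /= negb_or.
  by move=> /and4P[_ _ /andP[-> _]] /andP[->].
have [up uq] : uniq p /\ uniq q.
  by move: uc; rewrite /c /= cat_uniq /= => /and4P[_ -> _] /andP[_ ->].
have pq v : v \in p -> v \notin q.
  move: uc; rewrite /c /= cat_uniq /= negb_or => /and4P[_ _ /andP[_ hq] _] vp.
  by apply: contra hq => vq; apply/hasP; exists v.
have c2 : 2 < size c.
  by rewrite /c /= size_cat /=; case: (p) p0 => //= ? ? _; case: (q) q0 => //= ? ? _; rewrite !addnS.
pose d u v := ((u, v) \in carcs c) || [&& e a b, u == a & v == b].
have dC u v : d u v -> [/\ e u v, u \in c & v \in c].
  case/orP=> [uv|/and3P[eab /eqP-> /eqP->]].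
    by have [uC vC] := carcs_mem uv; split=> //; exact: carcs_adj cyc uv.
  by split=> //; rewrite /c !inE ?mem_cat ?inE eqxx ?orbT.
(* The successor of [b] on the cycle is the head of the nonempty [q], so the chord does not reverse
   an arc of the cycle. *)
have nab : (b, a) \notin carcs c.
  have [h [q' qE]] : exists h q', q = h :: q' by case: (q) q0 => // h q'; exists h, q'.
  have bh : (b, h) \in carcs c by rewrite /c carcs_split mem_cat qE /= !inE eqxx orbT.
  by apply: contra aq => ba; rewrite (carcs_fun uc ba bh) qE inE eqxx.
have dasym u v : ~~ (d u v && d v u).
  apply/negP=> /andP[/orP[uv|/and3P[_ /eqP ua /eqP vb]] /orP[vu|/and3P[_ /eqP va /eqP ub]]].
  - by have := carcs_asym uc c2 uv; rewrite vu.
  - by move: nab; rewrite -va -ub uv.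
  - by move: nab; rewrite -ua -vb vu.
  - by move: ab; rewrite -ua -ub eqxx.
exists d; split.
- move=> u v; split=> //; rewrite /induced !inE -!/(_ \in c).
  apply/and3P/orP=> [[euv uC vC]|[] /dC[]]; rewrite 1?e_sym //.
  have := chords u v uC vC euv; rewrite /d.
  case/or4P=> [->|->|/andP[ua vb]|/andP[ub va]]; [by left|by right|left|right].
    by rewrite ua vb -(eqP ua) -(eqP vb) euv orbT.
  by rewrite ub va -(eqP ub) -(eqP va) e_sym euv orbT.
- rewrite diffD_wdiff; pose X := if e a b then [set (a, b)] else set0.
  have -> : arcs d = [set x in parcs a (rcons p b)] :|: ([set x in parcs b (rcons q a)] :|: X).
    apply/setP=> [[u v]]; rewrite !inE /d /c carcs_split mem_cat -orbA; do 2!congr orb.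
    by rewrite /X; case: ifP => _; rewrite !inE.
  have X0 x : x \in X -> x = (a, b) by rewrite /X; case: ifP => _; rewrite !inE => // /eqP.
  rewrite wdiff_path //; last 2 first.
  + by move=> p00; rewrite p00 in p0.
  + move=> [u v]; rewrite !inE => /orP[/parcs_mem|/X0[-> ->] //].
    rewrite belast_rcons mem_rcons !inE => -[/orP[/eqP ->|uq'] /orP[/eqP ->|vq']] //=.
    * by split=> //; apply: contraL vq'; apply: pq.
    * by split=> //; apply: contraL uq'; apply: pq.
    * by split; [apply: contraL uq'|apply: contraL vq']; apply: pq.
  have qX x : x \in X -> x.1 \notin q /\ x.2 \notin q by move=> /X0 ->.
  have oq v : v \in q -> 0 + (a == v) = 0 + (b == v).
    move=> vq; congr (_ + nat_of_bool _).
    have -> : (a == v) = false by apply: contraNF aq => /eqP ->.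
    by have -> : (b == v) = false by apply: contraNF bq => /eqP ->.
  have sgn : ((-1) ^+ (size p).+1 * (-1) ^+ (size q).+1 = 1 :> int)%R.
    have szc : size c = (size p).+1 + (size q).+1 by rewrite /c /= size_cat.
    by rewrite -exprD -szc -signr_odd (negPf ec).
  have W0F (o i : T -> nat) v : o v != i v -> wdiff set0 o i = 0%R.
    by move=> oiv; rewrite wdiff0; case: forallP => // /(_ v); rewrite (negPf oiv).
  have W0T (o i : T -> nat) : (forall v, o v = i v) -> wdiff set0 o i = 1%R.
    by move=> oi; rewrite wdiff0; case: forallP => // -[] v; rewrite oi.
  have Xe o i : wdiff X o i = (wdiff set0 o i -
      (if e a b then wdiff set0 (fun v => o v + (a == v))%N (fun v => i v + (b == v))%N else 0))%R.
    rewrite /X; case: ifP => _; last by rewrite subr0.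
    by rewrite -(setU0 [set (a, b)]) wdiffU1 ?inE.
  have ba : (b == a) = false by rewrite eq_sym; apply: negPf.
  (* [X1] to [X4] are the contributions of the chord when neither path is taken, only the one from
     [b] to [a], only the one from [a] to [b], or both. *)
  have X1 : wdiff X (fun=> 0%N) (fun=> 0%N) = 1%R.
    rewrite Xe W0T // (W0F _ _ a) ?if_same ?subr0 //.
    by rewrite eqxx ba.
  have X2 : wdiff X (fun v => 0 + (b == v))%N (fun v => 0 + (a == v))%N
      = (if e a b then -1 else 0)%R.
    rewrite Xe (W0F _ _ a) ?eqxx ?ba // W0T ?sub0r; first by case: ifP; rewrite ?oppr0.
    by move=> v; rewrite addnAC.
  have X3 : wdiff X (fun v => 0 + (a == v))%N (fun v => 0 + (b == v))%N = 0%R.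
    rewrite Xe !(W0F _ _ a) ?eqxx ?ba // ?if_same ?subr0 //.
  have X4 : wdiff X (fun v => 0 + (a == v) + (b == v))%N (fun v => 0 + (b == v) + (a == v))%N
      = 1%R.
    rewrite Xe W0T => [|v]; last by rewrite addnAC.
    by rewrite (W0F _ _ a) ?if_same ?subr0 // eqxx ba.
  rewrite !wdiff_path //; try by move=> q00; rewrite q00 in q0.
  rewrite X1 X2 X3 X4 add0r mulr1 sgn -signr_odd.
  by case: (e a b); case: (odd _).
- move=> v; rewrite inE => vC.
  have [u uv] : exists u, (u, v) \in carcs c.
    by apply: parcs_in_r; rewrite mem_rcons.
  have [uC _] := carcs_mem uv.
  apply: proper_card; apply/properP; split.
    by apply/subsetP=> w; rewrite !inE => /dC[-> _ wC]; rewrite andbT.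
  have duv : d u v by rewrite /d uv.
  exists u; rewrite !inE; first by rewrite -[_ || _]/(u \in c) uC e_sym (carcs_adj cyc uv).
  by have := dasym u v; rewrite duv.
Qed.
End EvenCycle.

(* [lia] splits on every embedded boolean, so the atoms are generalized first. *)
Ltac atom_lia :=
  repeat match goal with
  | |- context [nat_of_bool ?b] => generalize (nat_of_bool b)
  | |- context [count ?P ?s] => generalize (count P s)
  | |- context [size ?s] => generalize (size s)
  end; clear; lia.

(** * Chords of a shortest even cycle *)

Section EvenCycles.
Variable T : finType.
Variable e : rel T.
Hypothesis e_sym : symmetric e.
Hypothesis e_irr : irreflexive e.
Variable S : {set T}.
Implicit Types (a b c u v : T) (p q s : seq T).

Definition evenc s :=
  [&& uniq s, cycle e s, all (mem S) s, ~~ odd (size s) & 3 < size s].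

Definition shortest_evenc s := evenc s /\ forall s', evenc s' -> size s <= size s'.

Lemma uniq_count_le1 s : (forall x, count_mem x s <= 1) -> uniq s.
Proof.
elim: s => //= x s IH H; rewrite IH ?andbT => [|y].
  by rewrite -has_pred1 has_count -leqNgt; have := H x; rewrite eqxx.
by apply: leq_trans (H y); rewrite leq_addl.
Qed.

(** A rerouted cycle uses each vertex at most as often as the old one. This single bound yields both
    distinctness and membership in [S], and it is linear arithmetic on multiplicities. *)
Lemma sub_evenc s0 s : uniq s0 -> all (mem S) s0 ->
  (forall x, count_mem x s <= count_mem x s0) ->
  cycle e s -> ~~ odd (size s) -> 3 < size s -> evenc s.
Proof.
move=> us0 S0 cnt cyc ev sz; rewrite /evenc cyc ev sz !andbT; apply/andP; split.
  by apply: uniq_count_le1 => x; apply: leq_trans (cnt x) _; rewrite count_uniq_mem // leq_b1.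
apply/allP=> x; rewrite -has_pred1 has_count => xs.
by apply: (allP S0); rewrite -has_pred1 has_count; apply: leq_trans xs (cnt x).
Qed.

Lemma evenc_catC s1 s2 : evenc (s1 ++ s2) -> evenc (s2 ++ s1).
Proof.
case/and5P=> us cyc Ss ev sz; apply: (sub_evenc us Ss).
- by move=> x; rewrite !count_cat addnC.
- by rewrite cycle_catC.
- by rewrite size_cat addnC -size_cat.
- by rewrite size_cat addnC -size_cat.
Qed.

Lemma shortest_evenc_catC s1 s2 : shortest_evenc (s1 ++ s2) -> shortest_evenc (s2 ++ s1).
Proof.
by case=> ev mn; split; [apply: evenc_catC | rewrite size_cat addnC -size_cat].
Qed.

Lemma ex_shortest_evenc s : evenc s -> exists s', shortest_evenc s'.
Proof.
move=> evs; pose Q n := [exists t : n.-tuple T, evenc t].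
have exQ : exists n, Q n by exists (size s); apply/existsP; exists (in_tuple s).
case: (ex_minnP exQ) => n /existsP[t evt] mn; exists t; split=> // s' evs'.
by rewrite size_tuple mn //; apply/existsP; exists (in_tuple s').
Qed.

Lemma path_rev a s b : path e a (rcons s b) = path e b (rcons (rev s) a).
Proof.
have := rev_path e a (rcons s b); rewrite last_rcons belast_rcons rev_cons => ->.
by apply: eq_path => u v; rewrite e_sym.
Qed.

Lemma path_split a p u q b :
  path e a (rcons (p ++ u :: q) b) = path e a (rcons p u) && path e u (rcons q b).
Proof. by rewrite rcons_cat rcons_cons -cat_rcons cat_path last_rcons. Qed.

(** If [p] had even length, the chord would close [a p b] to an even cycle that misses the vertices
    of [q]. *)
Lemma chord_odd a p b q : shortest_evenc (a :: p ++ b :: q) -> e a b ->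
  p != [::] -> q != [::] -> odd (size p).
Proof.
case=> /and5P[us cyc Ss ev sz] mn eab p0 q0; apply: contraT => np.
have p1 : 1 < size p by case: (p) p0 np => [|? [|]].
move: cyc; rewrite /= path_split => /andP[pth _].
have ev' : evenc (a :: rcons p b).
  apply: (sub_evenc us Ss).
  - by move=> x; rewrite /= -cats1 !count_cat /=; atom_lia.
  - by rewrite /= rcons_path last_rcons pth e_sym.
  - by rewrite /= size_rcons /= negbK.
  - by rewrite /= size_rcons.
have := mn _ ev'; rewrite /= size_cat size_rcons /= addnS !ltnS.
by case: (q) q0 => //= ? ? _; atom_lia.
Qed.

(** Otherwise [chord_odd] makes both the whole side from [a] to [b] and [p2] odd. Using both chords,
    [a p1 u v p3 b] is then an even cycle that misses [p2] and [q]. *)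
Lemma chord_same_side a p1 u p2 v p3 b q :
  shortest_evenc (a :: (p1 ++ u :: p2 ++ v :: p3) ++ b :: q) -> e a b -> q != [::] ->
  e u v -> p2 = [::].
Proof.
move=> sh eab q0 euv; apply/eqP; apply: contraT => p20.
have op : odd (size (p1 ++ u :: p2 ++ v :: p3)).
  by apply: (chord_odd sh) => //; case: (p1).
have op2 : odd (size p2).
  have sh' : shortest_evenc (u :: p2 ++ v :: (p3 ++ b :: q ++ a :: p1)).
    have := @shortest_evenc_catC (a :: p1) (u :: p2 ++ v :: p3 ++ b :: q).
    by rewrite /= -!catA /= -!catA /= in sh *; apply.
  by apply: (chord_odd sh') => //; case: (p3).
case: sh => /and5P[us cyc Ss ev sz] mn.
move: cyc; rewrite /= !path_split => /andP[/and3P[P1 P2 P3] P4].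
have szq : 0 < size q by case: (q) q0.
have szp : 0 < size p2 by case: (p2) p20.
have ev' : evenc (a :: (p1 ++ u :: v :: p3) ++ [:: b]).
  apply: (sub_evenc us Ss).
  - by move=> x; rewrite /= !count_cat /= !count_cat /=; atom_lia.
  - by rewrite /= !path_split /= P1 euv P3 e_sym eab.
  - by move: op op2; rewrite /= !size_cat /= !size_cat /=; atom_lia.
  - by rewrite /= !size_cat /=; atom_lia.
by move: szq szp (mn _ ev'); rewrite /= !size_cat /= !size_cat /=; atom_lia.
Qed.

(** By [chord_odd] all four segments have the same parity. Hence both cycles that use the two
    chords, one through [p1] and [q1], the other through [p2] and [q2], are even. Minimality against
    each empties the segments it misses, and the four remaining vertices span a K4. *)
Lemma chord_cross a p1 u p2 b q1 v q2 :
  shortest_evenc (a :: (p1 ++ u :: p2) ++ b :: (q1 ++ v :: q2)) -> e a b -> e u v ->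
  [/\ p1 = [::], p2 = [::], q1 = [::] & q2 = [::]].
Proof.
move=> sh eab euv.
have op : odd (size (p1 ++ u :: p2)).
  by apply: (chord_odd sh) => //; [case: (p1)|case: (q1)].
have oc : odd (size (p2 ++ b :: q1)).
  have sh' : shortest_evenc (u :: (p2 ++ b :: q1) ++ v :: (q2 ++ a :: p1)).
    have := @shortest_evenc_catC (a :: p1) (u :: p2 ++ b :: q1 ++ v :: q2).
    by rewrite /= -!catA /= -!catA /= in sh *; apply.
  by apply: (chord_odd sh') => //; [case: (p2)|case: (q2)].
case: sh => /and5P[us cyc Ss ev sz] mn.
move: cyc; rewrite /= !path_split => /andP[/andP[P1 P2] /andP[P3 P4]].
move: op oc ev; rewrite /= !size_cat /= !size_cat => op oc ev.
have ev1 : evenc (a :: (p1 ++ u :: v :: rev q1) ++ [:: b]).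
  apply: (sub_evenc us Ss).
  - by move=> x; rewrite /= !count_cat /= !count_cat /= count_rev; atom_lia.
  - by rewrite /= !path_split /= P1 euv -path_rev P3 e_sym eab.
  - by move: op oc ev; rewrite /= !size_cat /= size_rev; atom_lia.
  - by rewrite /= !size_cat /=; atom_lia.
have ev2 : evenc (a :: b :: rev p2 ++ u :: v :: q2).
  apply: (sub_evenc us Ss).
  - by move=> x; rewrite /= !count_cat /= !count_cat /= count_rev; atom_lia.
  - by rewrite /= eab path_split /= -path_rev P2 euv P4.
  - by move: op oc ev; rewrite /= !size_cat /= size_rev; atom_lia.
  - by rewrite /= !size_cat /=; atom_lia.
move: (mn _ ev1) (mn _ ev2); rewrite /= !size_cat /= !size_cat /= !size_rev => h1 h2.
by split; apply: size0nil; move: h1 h2; atom_lia.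
Qed.

Definition has_K4 := exists s,
  [/\ uniq s, size s = 4, all (mem S) s & {in s &, forall u v, u != v -> e u v}].

(** The two neighbours on the cycle and [b] are three distinct neighbours of [a], which exhausts its
    degree. *)
Lemma chord_end a p b q v : uniq (a :: p ++ b :: q) -> cycle e (a :: p ++ b :: q) ->
  all (mem S) (a :: p ++ b :: q) -> degS e S a <= 3 -> e a b ->
  p != [::] -> q != [::] -> v \in S -> e a v ->
  [|| (a, v) \in carcs (a :: p ++ b :: q), (v, a) \in carcs (a :: p ++ b :: q) | v == b].
Proof.
move=> us cyc Ss da eab p0 q0 vS eav.
case: p p0 us cyc Ss => // h p _; case/lastP: q q0 => // q l _ us cyc Ss.
have ah : (a, h) \in carcs (a :: (h :: p) ++ b :: rcons q l) by rewrite /= inE eqxx.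
have la : (l, a) \in carcs (a :: (h :: p) ++ b :: rcons q l).
  by rewrite carcs_split mem_cat orbC parcs_rcons last_rcons mem_rcons inE eqxx.
have Sx x : x \in [:: h; b; l] -> x \in S.
  move=> xs; apply: (allP Ss); move: xs; rewrite !inE mem_cat !inE mem_rcons !inE.
  by case/or3P=> ->; rewrite ?orbT.
have Nx x : x \in [:: h; b; l] -> e a x.
  rewrite !inE => /or3P[]/eqP -> //; first exact: carcs_adj cyc ah.
  by rewrite e_sym; apply: carcs_adj cyc la.
have u3 : uniq [:: h; b; l].
  apply: uniq_count_le1 => x.
  have : count_mem x (a :: (h :: p) ++ b :: rcons q l) <= 1 by rewrite count_uniq_mem // leq_b1.
  by rewrite -cats1 /= !count_cat /= !count_cat /=; atom_lia.
have E : [set x in [:: h; b; l]] = [set u in S | e a u].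
  apply/eqP; rewrite eqEcard; apply/andP; split.
    by apply/subsetP=> x; rewrite [in X in X -> _]inE => xs; rewrite inE Sx ?Nx.
  by apply: leq_trans da _; rewrite cardsE (card_uniqP u3).
have : v \in [set x in [:: h; b; l]] by rewrite E inE vS eav.
have -> : (v \in [set x in [:: h; b; l]]) = [|| v == h, v == b | v == l] by rewrite !inE.
by case/or3P=> /eqP ->; rewrite ?ah ?la ?eqxx ?orbT.
Qed.

(** The degree bound excludes a second chord at [a] or [b]. A pair inside one side must be
    consecutive, and a pair across the two sides gives a K4. *)
Lemma shortest_evenc_one_chord a p b q u v :
  (forall w, w \in S -> degS e S w <= 3) -> ~ has_K4 ->
  shortest_evenc (a :: p ++ b :: q) -> p != [::] -> q != [::] -> e a b ->
  u \in a :: p ++ b :: q -> v \in a :: p ++ b :: q -> e u v ->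
  [|| (u, v) \in carcs (a :: p ++ b :: q), (v, u) \in carcs (a :: p ++ b :: q),
      (u == a) && (v == b) | (u == b) && (v == a)].
Proof.
move=> deg3 nK4 sh p0 q0 eab.
have [/and5P[us cyc Ss _ _] _] := sh.
have cS w : w \in a :: p ++ b :: q -> w \in S by move/(allP Ss).
have sh' : shortest_evenc (b :: q ++ a :: p).
  exact: (@shortest_evenc_catC (a :: p) (b :: q)).
have [/and5P[us' cyc' Ss' _ _] _] := sh'.
have carcsC x : (x \in carcs (b :: q ++ a :: p)) = (x \in carcs (a :: p ++ b :: q)).
  exact: (carcs_catC (b :: q) (a :: p)).
have aS : a \in S by apply: cS; rewrite inE eqxx.
have bS : b \in S by apply: cS; rewrite inE mem_cat inE eqxx !orbT.
have enda w : w \in S -> e a w ->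
    [|| (a, w) \in carcs (a :: p ++ b :: q), (w, a) \in carcs (a :: p ++ b :: q) | w == b].
  by apply: chord_end => //; apply: deg3.
have endb w : w \in S -> e b w ->
    [|| (b, w) \in carcs (a :: p ++ b :: q), (w, b) \in carcs (a :: p ++ b :: q) | w == a].
  by rewrite -!carcsC; apply: chord_end => //; [apply: deg3|rewrite e_sym].
have sideP a' p' b' q' x y : shortest_evenc (a' :: p' ++ b' :: q') -> e a' b' -> q' != [::] ->
    x \in p' -> y \in p' -> e x y ->
    ((x, y) \in carcs (a' :: p' ++ b' :: q')) || ((y, x) \in carcs (a' :: p' ++ b' :: q')).
  move=> shh e' q0' xp yp exy.
  have xy : x != y by apply: contraTneq exy => ->; rewrite e_irr.
  case/splitPr: xp yp shh => p1 p2; rewrite mem_cat inE eq_sym (negPf xy) orFb.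
  case/orP=> /splitPr[p3 p4] shh.
    rewrite -catA cat_cons in shh *; rewrite e_sym in exy.
    have p40 := chord_same_side shh e' q0' exy.
    by rewrite p40; apply/orP; right; exact: carcs_consec.
  have p30 := chord_same_side shh e' q0' exy.
  by rewrite p30; apply/orP; left; exact: carcs_consec.
have crossP x y : x \in p -> y \in q -> e x y -> False.
  move=> xp yq exy; apply: nK4; case/splitPr: xp sh => p1 p2; case/splitPr: yq => q1 q2 sh2.
  have [E1 E2 E3 E4] := chord_cross sh2 eab exy.
  case: sh2; rewrite E1 E2 E3 E4 => /and5P[us2 cyc2 Ss2 _ _] _.
  exists [:: a; x; b; y]; split=> // z w; rewrite !inE.
  move: cyc2 => /= /and5P[e1 e2 e3 e4 _].
  by case/or4P=> /eqP ->; case/or4P=> /eqP ->; rewrite ?eqxx // => _; rewrite // e_sym.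
move=> uc vc euv; have := cS u uc; have := cS v vc => vS uS.
have [ua|ua] := eqVneq u a.
  by move: (enda v vS); rewrite -ua => /(_ euv)/or3P[->|->|->]; rewrite ?eqxx ?orbT.
have [ub|ub] := eqVneq u b.
  by move: (endb v vS); rewrite -ub => /(_ euv)/or3P[->|->|->]; rewrite ?eqxx ?orbT.
have [va|va] := eqVneq v a.
  move: (enda u uS); rewrite -va e_sym => /(_ euv)/or3P[->|->|/eqP ub']; rewrite ?orbT //.
  by rewrite ub' eqxx in ub.
have [vb|vb] := eqVneq v b.
  move: (endb u uS); rewrite -vb e_sym => /(_ euv)/or3P[->|->|/eqP ub']; rewrite ?orbT //.
  by rewrite ub' eqxx in ua.
rewrite /= !orbF.
move: uc vc; rewrite !inE (negPf ua) (negPf va) !mem_cat !inE (negPf ub) (negPf vb) /=.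
case/orP=> [up|uq] /orP[vp|vq].
- exact: sideP.
- by case: (crossP u v).
- by case: (crossP v u) => //; rewrite e_sym.
- by rewrite -!carcsC; apply: sideP => //; rewrite e_sym.
Qed.

Lemma evenc_AT s : (forall w, w \in S -> degS e S w <= 3) -> ~ has_K4 -> evenc s ->
  exists B : {set T}, [/\ B \subset S, B != set0 & AT_on e B (degS e B)].
Proof.
move=> deg3 nK4 /ex_shortest_evenc[{}s sh].
have splitAT a p b q : shortest_evenc (a :: p ++ b :: q) -> p != [::] -> q != [::] ->
   (forall u v, u \in a :: p ++ b :: q -> v \in a :: p ++ b :: q -> e u v ->
     [|| (u, v) \in carcs (a :: p ++ b :: q), (v, u) \in carcs (a :: p ++ b :: q),
         (u == a) && (v == b) | (u == b) && (v == a)]) ->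
   exists B : {set T}, [/\ B \subset S, B != set0 & AT_on e B (degS e B)].
  move=> [/and5P[us cyc Ss ev sz] _] p0 q0 chords.
  exists [set x in a :: p ++ b :: q]; split.
  - by apply/subsetP=> x; rewrite inE => /(allP Ss).
  - by apply/set0Pn; exists a; rewrite !inE eqxx.
  - exact: cycle_AT.
have [/existsP[a /existsP[b]]|nochord] :=
  boolP [exists a, exists b, [&& a \in s, b \in s, e a b,
     (a, b) \notin carcs s & (b, a) \notin carcs s]].
  case/and5P=> as_ bs eab nab nba.
  case/splitPr: as_ sh bs nab nba => s1 s2 /shortest_evenc_catC.
  rewrite mem_cat !(carcs_catC s1) orbC -mem_cat cat_cons.
  have ab : b != a by apply: contraTneq eab => ->; rewrite e_irr.
  set t := s2 ++ s1 => sh; rewrite inE (negPf ab) /= => bt.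
  case/splitPr: bt sh => p q sh nab nba.
  have p0 : p != [::] by apply: contraNneq nab => ->; rewrite /= inE eqxx.
  have q0 : q != [::].
    by apply: contraNneq nba => ->; rewrite /carcs parcs_rcons last_cat mem_rcons inE eqxx.
  apply: (splitAT _ _ _ _ sh p0 q0) => u v uc vc euv.
  exact: (shortest_evenc_one_chord deg3 nK4 sh p0 q0 eab uc vc euv).
have [/and5P[us cyc Ss ev sz] _] := sh.
(* Without a chord any two cycle vertices with nonempty sides can play [a] and [b]; vertices at
   distance two are taken. *)
case: s sh nochord us cyc Ss ev sz => [|a [|c [|b [|d s]]]] // sh nochord _ _ _ _ _.
apply: (splitAT a [:: c] b (d :: s)) => // u v us vs euv.
have := existsPn nochord u => /existsPn/(_ v).
by rewrite us vs euv /= negb_and !negbK => /orP[->|->]; rewrite ?orbT.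
Qed.

End EvenCycles.

(** * Longest paths *)

Section LongestPath.
Variable T : finType.
Variable e : rel T.
Hypothesis e_sym : symmetric e.
Hypothesis e_irr : irreflexive e.
Variable S : {set T}.
Implicit Types (a b c u v : T) (p q s : seq T).

Definition spath s := [&& uniq s, all (mem S) s & sorted e s].

Definition longest s := spath s /\ forall s', spath s' -> size s' <= size s.

Lemma ex_longest : S != set0 -> exists v q, longest (v :: q).
Proof.
case/set0Pn=> w wS; pose Q n := [exists t : n.-tuple T, spath t].
have Q1 : Q 1 by apply/existsP; exists [tuple w]; rewrite /spath /= wS.
have QT n : Q n -> n <= #|T|.
  case/existsP=> t /and3P[/card_uniqP ct _ _].
  by rewrite -[n in n <= _](size_tuple t) -ct max_card.
have exQ : exists n, Q n by exists 1.
case: (ex_maxnP exQ QT) => n /existsP[[s /= /eqP sz] ps] mx.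
have mxs s' : spath s' -> size s' <= size s.
  by move=> ps'; rewrite sz mx //; apply/existsP; exists (in_tuple s').
case: s sz ps mxs => [|v q] sz ps mxs; last by exists v, q.
by have := mx 1 Q1; rewrite -sz.
Qed.

Lemma longest_count s s' : longest s -> (forall x, count_mem x s' = count_mem x s) ->
  sorted e s' -> longest s'.
Proof.
move=> [/and3P[us Ss _] mx] cnt srt; have ps : perm_eq s' s by apply/allP=> x _; apply/eqP.
split; last by rewrite (perm_size ps).
by rewrite /spath (perm_uniq ps) us srt (perm_all _ ps) Ss.
Qed.

(** A neighbour of the end off the path would extend it. *)
Lemma longest_nbr v q u : longest (v :: q) -> u \in S -> e v u -> u \in q.
Proof.
move=> [/and3P[us Ss srt] mx] uS evu; apply: contraT => uq.
have uv : u != v by apply: contraTneq evu => ->; rewrite e_irr.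
have := mx (u :: v :: q); rewrite ltnn => H; apply: contraT => _; apply: H.
by move: us Ss srt; rewrite /spath /= inE negb_or uv uq uS e_sym evu => -> -> ->.
Qed.

Lemma sorted_rev s : sorted e (rev s) = sorted e s.
Proof. by rewrite rev_sorted; apply: eq_sorted => u v; rewrite e_sym. Qed.

Lemma longest_rev s : longest s -> longest (rev s).
Proof.
move=> L; apply: longest_count (L) _ _ => [x|]; first by rewrite count_rev.
by rewrite sorted_rev; case: L => /and3P[].
Qed.

(** Pósa rotation: the edge from [v] to [b] replaces the path edge entering [b], and the predecessor
    of [b] becomes the new end. *)
Lemma longest_rotate v q1 b q2 : longest (v :: q1 ++ b :: q2) -> e v b ->
  longest (rev (v :: q1) ++ b :: q2).
Proof.
move=> L evb; apply: longest_count (L) _ _ => [x|].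
  by rewrite count_cat count_rev -count_cat.
case: L => /and3P[_ _]; rewrite -cat_cons sorted_cat_cons => /andP[s1 s2] _.
rewrite sorted_cat_cons s2 andbT rev_cons -rev_cons.
rewrite -sorted_rev rev_rcons revK /= e_sym evb /=.
by move: s1; rewrite -cats1 => /cat_sorted2[].
Qed.

Lemma longest_evenc1 v q1 b q2 : longest (v :: q1 ++ b :: q2) -> e v b ->
  q1 != [::] -> ~~ odd (size q1) -> evenc e S (v :: rcons q1 b).
Proof.
move=> [/and3P[us Ss srt] _] evb q0 ev; apply: (sub_evenc us Ss).
- by move=> x; rewrite /= -cats1 !count_cat /=; atom_lia.
- move: srt; rewrite /= -cat_rcons cat_path => /andP[pth _].
  by rewrite rcons_path pth last_rcons e_sym.
- by rewrite /= size_rcons /= negbK.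
- by rewrite /= size_rcons; case: (q1) q0 ev => [|? [|]].
Qed.

Lemma longest_evenc2 v q1 b q2 c q3 : longest (v :: q1 ++ b :: q2 ++ c :: q3) ->
  e v b -> e v c -> odd (size q2) -> evenc e S (v :: b :: rcons q2 c).
Proof.
move=> [/and3P[us Ss srt] _] evb evc ev; apply: (sub_evenc us Ss).
- by move=> x; rewrite /= -cats1 !count_cat /= !count_cat /=; atom_lia.
- have {srt} : path e b (q2 ++ c :: q3) by move: srt; rewrite /= cat_path /= => /and3P[].
  rewrite -cat_rcons cat_path /= => /andP[pth _].
  by rewrite rcons_path pth last_rcons evb e_sym.
- by rewrite /= size_rcons /= !negbK.
- by rewrite /= size_rcons; case: (q2) ev.
Qed.

(** All neighbours of [v] lie on the path. The path with the edges from [v] to three of them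
    contains a theta graph, and the parities of its segments make one of its three cycles even. *)
Lemma longest_head3 v q : longest (v :: q) -> 2 < degS e S v -> exists s, evenc e S s.
Proof.
move=> L dv; have nq u : u \in S -> e v u -> u \in q by exact: longest_nbr L.
case: q L nq => [|h q] L nq.
  have /card_gt0P[u] : 0 < degS e S v by apply: leq_trans dv.
  by rewrite inE => /andP[uS evu]; have := nq u uS evu.
have : 1 < #|[set u in S | e v u] :\ h|.
  by move: dv; rewrite /degS (cardsD1 h); case: (h \in _) => //= /ltnW.
have Nq u : u \in [set u in S | e v u] :\ h -> u \in q /\ e v u.
  rewrite !inE => /and3P[uh uS evu]; split=> //.
  by have := nq u uS evu; rewrite inE (negPf uh).
case/card_gt1P=> b [c] [/Nq[bq evb] /Nq[cq evc] bc].
have main r1 x r2 y r3 : longest (v :: h :: r1 ++ x :: r2 ++ y :: r3) -> e v x -> e v y ->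
    exists s, evenc e S s.
  move=> Lr evx evy; have [o1|o1] := boolP (odd (size (h :: r1))); last first.
    by exists (v :: rcons (h :: r1) x); apply: (@longest_evenc1 v (h :: r1) x _ Lr).
  have [o2|o2] := boolP (odd (size r2)).
    by exists (v :: x :: rcons r2 y); apply: (@longest_evenc2 v (h :: r1) x r2 y r3).
  have Lr' : longest (v :: (h :: r1 ++ x :: r2) ++ y :: r3) by rewrite /= -catA.
  exists (v :: rcons (h :: r1 ++ x :: r2) y).
  apply: (@longest_evenc1 v (h :: r1 ++ x :: r2) y _ Lr') => //.
  by move: o1 o2; rewrite /= size_cat /=; atom_lia.
case/splitPr: bq cq L => r1 r2; rewrite mem_cat inE eq_sym (negPf bc) /=.
case/orP=> /splitPr[r3 r4] L; last exact: main L evb evc.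
by rewrite -catA /= in L; apply: main L evc evb.
Qed.

Lemma longest_head2 v q : longest (v :: q) -> 1 < degS e S v -> (forall s, ~ evenc e S s) ->
  exists q1 b q2, [/\ q = q1 ++ b :: q2, e v b & odd (size q1)].
Proof.
move=> L dv noev; case: q L => [|h q] L.
  have /card_gt0P[u] : 0 < degS e S v by apply: leq_trans dv.
  by rewrite inE => /andP[uS evu]; have := longest_nbr L uS evu.
have /card_gt0P[b] : 0 < #|[set u in S | e v u] :\ h|.
  by move: dv; rewrite /degS (cardsD1 h); case: (h \in _) => //= /ltnW.
rewrite !inE => /and3P[bh bS evb]; have := longest_nbr L bS evb.
rewrite inE (negPf bh) /= => bq; case/splitPr: bq L => r1 r2 L.
exists (h :: r1), b, r2; split=> //; apply: contraT => o1.
by case: (noev (v :: rcons (h :: r1) b)); apply: (@longest_evenc1 v (h :: r1) b _ L).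
Qed.

(** Without even cycles every end of a longest path lies in [P]. Rotations at both ends of one path
    supply more ends than [P] can hold, unless the path is a triangle. *)
Lemma evenc_or_triangle (P : {set T}) : S != set0 -> #|P| <= 3 ->
  (forall v, v \in S -> 1 < degS e S v) ->
  (forall v, v \in S -> v \notin P -> 2 < degS e S v) ->
  (forall s, ~ evenc e S s) ->
  exists u v w, [/\ uniq [:: u; v; w], [set u; v; w] \subset P, e u v, e v w & e u w].
Proof.
move=> S0 P3 deg2 deg3 noev; have [v [q L]] := ex_longest S0.
have headS u s : longest (u :: s) -> u \in S by case=> /and3P[_ /andP[]].
have headP u s : longest (u :: s) -> u \in P.
  move=> Lu; apply: contraT => uP; have uS := headS _ _ Lu.
  by have [s' /noev] := longest_head3 Lu (deg3 u uS uP).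
have [q1 [b [q2 [qE evb o1]]]] := longest_head2 L (deg2 v (headS _ _ L)) noev.
have [r1 [d [r2 [rE ewd o3]]]] : exists r1 d r2,
    [/\ rev (belast v q) = r1 ++ d :: r2, e (last v q) d & odd (size r1)].
  have Lr : longest (last v q :: rev (belast v q)) by rewrite -rev_rcons -lastI; apply: longest_rev.
  exact: longest_head2 Lr (deg2 _ (headS _ _ Lr)) noev.
have vP : v \in P := headP _ _ L.
(* Vertices are now compared by position on the path. The ends [v] and [last v q] have positions 0
   and [size q]; the rotations make positions [size q1] and [size q - size r1] ends as well. *)
pose nthp k := nth v (v :: q) k.
have szq : size q = (size r1 + size r2).+1.
  by move/(congr1 size): rE; rewrite size_rev size_belast size_cat /= addnS.
have szq' : size q = (size q1 + size q2).+1 by rewrite qE size_cat /= addnS.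
have uP : nthp (size q1) \in P.
  have := longest_rotate (q1 := q1) (q2 := q2) (b := b) (v := v).
  rewrite -qE => /(_ L evb) Lr.
  have : nthp (size q1) = last v q1.
    by rewrite /nthp qE -cat_cons nth_cat /= ltnS leqnn (last_nth v).
  move=> ->; move: Lr; rewrite lastI rev_rcons cat_cons; exact: headP.
have wP : nthp (size q) \in P.
  rewrite /nthp -last_nth.
  by apply: (headP _ (rev (belast v q))); rewrite -rev_rcons -lastI; apply: longest_rev.
have revnth k : k <= size q -> nth v (last v q :: rev (belast v q)) k = nthp (size q - k).
  by move=> kq; rewrite -rev_rcons -lastI nth_rev //= subSS.
have xP : nthp (size q - size r1) \in P.
  rewrite -revnth; last by rewrite szq; atom_lia.
  have Lr : longest (last v q :: r1 ++ d :: r2).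
    by rewrite -rE -rev_rcons -lastI; apply: longest_rev.
  have := longest_rotate Lr ewd; rewrite lastI rev_rcons cat_cons => /headP.
  rewrite rE -cat_cons nth_cat /= ltnS leqnn.
  by rewrite -(last_nth v (last v q) r1).
have dE : nthp (size q - (size r1).+1) = d.
  rewrite -revnth; last by rewrite szq; atom_lia.
  by rewrite rE -cat_cons nth_cat /= ltnn subnn.
have nthI i j : i <= size q -> j <= size q -> (nthp i == nthp j) = (i == j).
  by move=> iq jq; apply: nth_uniq => //; case: L => /and3P[].
(* Four distinct ends do not fit in [P], and each rotated end differs from both original ones, so
   the two rotated ends coincide. *)
have sum_m : size q1 + size r1 = size q.
  apply/eqP; apply: contraT => ne.
  have ord : [&& 0 < size q1, size q1 < size q, 0 < size q - size r1,
                 size q - size r1 < size q & size q1 != size q - size r1].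
    by move: szq szq' o1 o3 ne; atom_lia.
  have : uniq [:: nthp 0; nthp (size q1); nthp (size q - size r1); nthp (size q)].
    case/and5P: ord => h1 h2 h3 h4 h5.
    rewrite /= !inE !nthI ?leq_subr ?(ltnW h2) // (negPf h5) !(ltn_eqF h1) !(ltn_eqF h2).
    by rewrite (ltn_eqF h3) (ltn_eqF h4) (ltn_eqF (ltn_trans h1 h2)).
  move=> /card_uniqP /= c4; have : 4 <= #|P|.
    rewrite -c4; apply: subset_leq_card; apply/subsetP=> z.
    by rewrite !inE => /or4P[]/eqP ->.
  by rewrite leqNgt ltnS P3.
case/lastP: q1 => [//|q0 u] in qE o1 szq' uP sum_m *.
have dE' : d = last v q0.
  rewrite -dE -sum_m size_rcons (_ : _ - _ = size q0); last by atom_lia.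
  by rewrite /nthp qE -cat_cons nth_cat /= size_rcons ltnS leqnSn -cats1 -cat_cons nth_cat
    /= ltnS leqnn (last_nth v).
have uE : nthp (size q0).+1 = u.
  by rewrite /nthp qE -cat_cons nth_cat /= size_rcons ltnS leqnn nth_rcons ltnn eqxx.
have wE : last v q = last b q2 by rewrite qE last_cat last_cons.
have [us Ss srt] : [/\ uniq (v :: q), all (mem S) (v :: q) & path e v q].
  by case: L => /and3P[].
have pth : path e v (rcons q0 u) /\ path e b q2 /\ e u b.
  by move: srt; rewrite qE cat_path last_rcons /= => /and3P[-> -> ->].
(* The common rotated end [u] lies between [d] and [b]. The edges from [v] to [b] and from
   [last v q] to [d] close a cycle through all path vertices but [u]. Its length [size q] is even,
   as a sum of two odd numbers. *)
have even0 : evenc e S (v :: q0 ++ rev (b :: q2)) \/ size q <= 3.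
  have [|q3] := leqP (size q) 3; first by right.
  left; apply: (sub_evenc us Ss).
  - by move=> x; rewrite qE -cats1 /= !count_cat /= count_rev /= ?count_cat /=; atom_lia.
  - rewrite /= rcons_cat cat_path.
    case: pth => p0 [p2 _].
    move: p0; rewrite rcons_path => /andP[-> _] /=.
    rewrite rev_cons rcons_path last_rcons e_sym evb andbT.
    case/lastP: q2 => [|q2 w] in qE szq' wE p2 *.
      by rewrite /= andbT -dE' e_sym -[b]/(last b [::]) -wE.
    by rewrite rev_rcons /= -(path_rev e_sym) p2 -dE' e_sym -(last_rcons b q2 w) -wE ewd.
  - by move: o1 o3; rewrite /= size_cat size_rev /= size_rcons; move: sum_m szq'; rewrite size_rcons; atom_lia.
  - by rewrite /= size_cat size_rev /=; move: q3; rewrite szq' size_rcons; atom_lia.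
case: even0 => [/noev //|q3].
move: o1 o3 sum_m szq'; rewrite size_rcons => o1 o3 sum_m szq'.
(* An even [size q] that is at most 3 must be 2, so the path is [v u b] and the edge from [v] to [b]
   closes the triangle. *)
have q00 : q0 = [::] by apply: size0nil; move: o1 o3 sum_m szq' q3; atom_lia.
have q20 : q2 = [::] by apply: size0nil; move: o1 o3 sum_m szq' q3; atom_lia.
have q2s : size q = 2 by rewrite szq' q00 q20.
exists v, u, b; have [p0 [p2 eub]] := pth; rewrite q00 /= andbT in p0.
have bP : b \in P by move: wP; rewrite /nthp -last_nth wE q20.
have uP' : u \in P by rewrite -uE -(size_rcons q0 u).
split=> //; first by move: us; rewrite qE q00 q20.
by apply/subsetP=> z; rewrite !inE => /orP[/orP[]|]/eqP ->.
Qed.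

End LongestPath.

(** * Enumeration of the graphs with surplus one *)

Definition pair_t := (nat * nat)%type.

Definition touches (u : nat) (L : seq pair_t) := has (fun p => (p.1 == u) || (p.2 == u)) L.

(* The pair counts the balanced sub-lists of even and of odd size; a branch is cut
   as soon as a vertex no longer met by L is unbalanced. *)
Fixpoint euler_count (L : seq pair_t) (o i : seq nat) : nat * nat :=
  if L is (u, v) :: L' then
    let rec o i :=
      if (touches u L' || (nth 0 o u == nth 0 i u))
         && (touches v L' || (nth 0 o v == nth 0 i v))
      then euler_count L' o i else (0, 0) in
    let: (a, b) := rec o i in
    let: (c, d) := rec (incr_nth o u) (incr_nth i v) in
    (a + d, b + c)
  else if o == i then (1, 0) else (0, 0).

(* E lists the edges still to be oriented, L the oriented ones, and cap the
   remaining out-degree allowed at each vertex. *)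
Fixpoint find_orientation n (E L : seq pair_t) (cap : seq nat) : bool :=
  match E with
  | [::] => let: (a, b) := euler_count L (nseq n 0) (nseq n 0) in a != b
  | (i, j) :: E' =>
    if (if 0 < nth 0 cap j then
          find_orientation n E' ((j, i) :: L) (set_nth 0 cap j (nth 0 cap j).-1) else false)
    then true
    else if 0 < nth 0 cap i then
      find_orientation n E' ((i, j) :: L) (set_nth 0 cap i (nth 0 cap i).-1) else false
  end.

(* An edge is tested when its larger end, the last vertex of c, gets its colour. *)
Definition color_clash (E : seq pair_t) (c : seq nat) :=
  has (fun p => (maxn p.1 p.2 == (size c).-1) && (nth 0 c p.1 == nth 0 c p.2)) E.

Fixpoint rainbow_forced m (E : seq pair_t) (c : seq nat) : bool :=
  if m is m'.+1 then
    all (fun k => let c' := rcons c k in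
      if color_clash E c' then true else rainbow_forced m' E c') [:: 0; 1; 2]
  else uniq (take 3 c).

(** The vertices 0, 1, 2 stand for x, y, z, and the caps are [f - 1]. The [if] spares the
    orientation search under call-by-value evaluation. *)
Definition leaf n E :=
  if rainbow_forced n E [::] then true
  else find_orientation n E [::] (1 :: 1 :: 1 :: nseq (n - 3) 2).

(* Chooses the neighbours of i among the vertices j, j + 1, ...; r is the number
   of neighbours i still needs and rem the same for these later vertices. *)
Fixpoint pick_row (i r : nat) (rem : seq nat) (j : nat) (acc : seq nat) (E : seq pair_t)
    (k : seq nat -> seq pair_t -> bool) : bool :=
  match rem with
  | [::] => if r == 0 then k (rev acc) E else true
  | x :: rem' =>
    if pick_row i r rem' j.+1 (x :: acc) E k then
      if (0 < r) && (0 < x) then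
        pick_row i r.-1 rem' j.+1 (x.-1 :: acc) ((i, j) :: E) k
      else true
    else false
  end.

Definition key (E : seq pair_t) v :=
  ((0, v) \in E).*2.*2 + ((1, v) \in E).*2 + ((2, v) \in E).

(* Symmetry breaking: the vertices other than 0, 1, 2 come sorted by their
   adjacency to 0, 1, 2, which is known once rows 0, 1, 2 are chosen. *)
Definition row_ok n i E :=
  if i == 2 then sorted geq [seq key E v | v <- iota 3 (n - 3)] else true.

Fixpoint rows n m (i : nat) (rem : seq nat) (E : seq pair_t) : bool :=
  match m, rem with
  | m'.+1, r :: rem' =>
    pick_row i r rem' i.+1 [::] E
      (fun rem'' E' => if row_ok n i E' then rows n m' i.+1 rem'' E' else true)
  | _, _ => leaf n E
  end.

(** The values of [f] with the single unit of surplus placed at [w]. *)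
Definition degree_targets n w := incr_nth (2 :: 2 :: 2 :: nseq (n - 3) 3) w.

Definition check n := all (fun w => rows n n 0 (degree_targets n w) [::]) (iota 0 n).

(** * Soundness of the enumeration *)

Section Soundness.
Variables (n : nat) (adj : rel nat).
Hypothesis adj_sym : symmetric adj.
Hypothesis adj_irr : irreflexive adj.

(** The order of the list is the one in which [rows] accumulates the edges, so the two agree as
    lists and not only as sets. *)
Fixpoint edges_to i : seq pair_t :=
  if i is i'.+1 then
    rev [seq (i', v) | v <- iota i (n - i) & adj i' v] ++ edges_to i'
  else [::].

Lemma edges_to_mem i u v : ((u, v) \in edges_to i) = [&& u < i, u < v < n & adj u v].
Proof.
elim: i => //= i IH; rewrite mem_cat mem_rev IH ltnS.
have -> : ((u, v) \in [seq (i, v0) | v0 <- iota i.+1 (n - i.+1) & adj i v0])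
    = [&& u == i, u < v < n & adj u v].
  apply/mapP/idP=> [[w]|/and3P[/eqP -> vn uv]].
    rewrite mem_filter mem_iota => /andP[iw wn] [-> ->]; rewrite eqxx iw andbT /=.
    by move: wn; lia.
  by exists v => //; rewrite mem_filter mem_iota uv /=; move: vn; lia.
by rewrite -andb_orl -leq_eqVlt.
Qed.

Lemma edges_to_uniq i : uniq (edges_to i).
Proof.
elim: i => //= i IH; rewrite cat_uniq IH andbT rev_uniq; apply/andP; split.
  by rewrite map_inj_uniq ?filter_uniq ?iota_uniq // => u v [].
apply/hasPn=> [[u v]]; rewrite edges_to_mem => /andP[ui _]; rewrite /= mem_rev.
by apply/negP=> /mapP[w _ [uE _]]; rewrite uE ltnn in ui.
Qed.

(** A search that succeeds on all branches succeeds on the one that agrees with [adj]. That branch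
    is never cut, and it hands the continuation the reduced degrees and the row of [adj]. *)
Lemma pick_row_sound i r rem j acc E k :
  pick_row i r rem j acc E k -> r = count (adj i) (iota j (size rem)) ->
  (forall t, t < size rem -> adj i (j + t) -> 0 < nth 0 rem t) ->
  k (rev acc ++ [seq nth 0 rem t - adj i (j + t) | t <- iota 0 (size rem)])
    (rev [seq (i, v) | v <- iota j (size rem) & adj i v] ++ E).
Proof.
elim: rem r j acc E => [|x rem IH] r j acc E /=.
  by move=> + r0; rewrite r0 /= cats0.
case: ifP => // noj yesj rE pos.
have pos' t : t < size rem -> adj i (j.+1 + t) -> 0 < nth 0 rem t.
  by move=> ts; rewrite addSnnS => /(pos t.+1 ts).
have tailE : [seq nth 0 (x :: rem) t - adj i (j + t) | t <- iota 1 (size rem)]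
    = [seq nth 0 rem t - adj i (j.+1 + t) | t <- iota 0 (size rem)].
  by rewrite (iotaDl 1 0) -map_comp; apply: eq_map => t /=; rewrite add1n addSnnS.
rewrite tailE addn0; have := pos 0 isT; rewrite addn0 /=.
move: rE yesj; case: (adj i j) => /= rE.
  move=> + /(_ isT) x0; rewrite rE x0 /= => /IH/(_ erefl pos').
  by rewrite rev_cons cat_rcons rev_cons cat_rcons subn1.
move=> _ _; have := IH _ _ _ _ noj rE pos'.
by rewrite rev_cons cat_rcons subn0.
Qed.

Definition sorted_keys :=
  sorted geq [seq (adj 0 v).*2.*2 + (adj 1 v).*2 + adj 2 v | v <- iota 3 (n - 3)].

(** Invariant before row [i]: the remaining degree of a vertex is the number of its neighbours among
    [i] and the later vertices. At [i = 0] these are the full degrees. *)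
Lemma rows_sound m i : i + m = n -> sorted_keys ->
  rows n m i [seq count (adj v) (iota i m) | v <- iota i m] (edges_to i) ->
  leaf n (edges_to n).
Proof.
elim: m i => [|m IH] i im srt /=; first by rewrite addn0 in im; rewrite im.
rewrite adj_irr add0n => H.
have ni : n - i.+1 = m by rewrite -im addnS -addSn addKn.
have := pick_row_sound H; rewrite size_map size_iota => /(_ erefl) {}H.
apply: (IH i.+1); rewrite ?addSnnS //.
have {}H := H _; rewrite /= in H.
have /H : forall t, t < m -> adj i (i.+1 + t) ->
    0 < nth 0 [seq adj v i + count (adj v) (iota i.+1 m) | v <- iota i.+1 m] t.
  move=> t tm; rewrite (nth_map 0) ?size_iota // nth_iota // adj_sym => ->.
  by rewrite add1n.
have -> : [seq nth 0 [seq adj v i + count (adj v) (iota i.+1 m) | v <- iota i.+1 m] t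
     - adj i (i.+1 + t) | t <- iota 0 m] = [seq count (adj v) (iota i.+1 m) | v <- iota i.+1 m].
  apply: (@eq_from_nth _ 0) => [|t]; rewrite !size_map !size_iota // => tm.
  rewrite !(nth_map 0) ?size_iota // !nth_iota // !add0n.
  by rewrite adj_sym addKn.
rewrite -ni -[rev _ ++ _]/(edges_to i.+1) ni.
rewrite /row_ok; case: eqP => [i2|//]; rewrite (_ : sorted _ _ = true) //.
rewrite -[RHS]srt; congr (sorted _ _); apply/eq_in_map => v; rewrite mem_iota => /andP[v3 vn].
have v_lt : v < n by move: vn; rewrite -im i2; lia.
rewrite /key !edges_to_mem i2 v_lt !andbT /=.
by rewrite v3 (ltnW v3) (ltnW (ltnW v3)).
Qed.

(** The search is followed along the branch that colours by [phi]; properness means that no clash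
    ever cuts it. *)
Lemma rainbow_forced_sound (phi : nat -> nat) E m j :
  {in E, forall p, phi p.1 != phi p.2} -> (forall k, phi k < 3) ->
  rainbow_forced m E [seq phi k | k <- iota 0 j] ->
  uniq (take 3 [seq phi k | k <- iota 0 (j + m)]).
Proof.
move=> prop phi3; elim: m j => [|m IH] j; first by rewrite addn0.
move/allP/(_ (phi j)); rewrite !inE.
have -> : [|| phi j == 0, phi j == 1 | phi j == 2] by move: (phi3 j); case: (phi j) => [|[|[]]].
move=> /(_ isT) /=.
have -> : rcons [seq phi k | k <- iota 0 j] (phi j) = [seq phi k | k <- iota 0 j.+1].
  by rewrite -addn1 iotaD map_cat cats1.
rewrite -addSnnS; case: ifP => [|_]; last exact: IH.
case/hasP=> -[u v] /prop uv /andP[/eqP]; rewrite size_map size_iota => mx.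
have [uj vj] : u < j.+1 /\ v < j.+1 by rewrite !ltnS -[j]mx leq_maxl leq_maxr.
by rewrite !(nth_map 0) ?size_iota // !nth_iota // (negPf uv).
Qed.

(** The undirected edge under an arc, written as in [edges_to] with the smaller end in front. *)
Definition norm (p : pair_t) : pair_t := (minn p.1 p.2, maxn p.1 p.2).

Lemma find_orientation_sound E L cap :
  find_orientation n E L cap -> {in E, forall p, p.1 < p.2} ->
  exists L2, [/\ [seq norm p | p <- L2] = rev E,
                 forall k, count (fun p => p.1 == k) L2 <= nth 0 cap k &
                 let ab := euler_count (L2 ++ L) (nseq n 0) (nseq n 0) in ab.1 != ab.2].
Proof.
elim: E L cap => [|[i j] E IH] L cap /=; first by move=> H _; exists [::]; split=> //=; case: euler_count H.
move=> H lt; have ij : i < j by apply: (lt (i, j)); rewrite inE eqxx.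
have lt' : {in E, forall p, p.1 < p.2} by move=> p pE; apply: lt; rewrite inE pE orbT.
have step p : norm p = (i, j) -> 0 < nth 0 cap p.1 ->
    find_orientation n E (p :: L) (set_nth 0 cap p.1 (nth 0 cap p.1).-1) ->
    exists L2, [/\ [seq norm p | p <- L2] = rev ((i, j) :: E),
                 forall k, count (fun p => p.1 == k) L2 <= nth 0 cap k &
                 let ab := euler_count (L2 ++ L) (nseq n 0) (nseq n 0) in ab.1 != ab.2].
  move=> np cp /IH/(_ lt')[L2 [nL2 cL2 eL2]]; exists (rcons L2 p); split.
  - by rewrite map_rcons nL2 np rev_cons.
  - move=> k; have := cL2 k; rewrite nth_set_nth /= -cats1 count_cat /= addn0 eq_sym.
    case: eqP cp => [->|_] cp; last by rewrite addn0.
    by move=> h; rewrite addn1; apply: leq_ltn_trans h _; rewrite prednK.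
  - by rewrite cat_rcons.
move: H; case: ifP => [|_].
  case: ifP => // cj F _; apply: (step (j, i)) => //.
  by rewrite /norm /= minnC maxnC (minn_idPl (ltnW ij)) (maxn_idPr (ltnW ij)).
case: ifP => // ci F; apply: (step (i, j)) => //.
by rewrite /norm /= (minn_idPl (ltnW ij)) (maxn_idPr (ltnW ij)).
Qed.

End Soundness.

Lemma check_small n : n \in [:: 4; 6; 8] -> check n.
Proof. by rewrite !inE => /or3P[]/eqP ->; vm_compute. Qed.

(** * From numbered graphs back to induced subgraphs *)

Section Transfer.
Variable T : finType.
Variable x0 : T.
Variable s : seq T.
Hypothesis s_uniq : uniq s.
Local Notation f := (nth x0 s).
Local Notation n := (size s).

Definition arc_of (p : pair_t) : T * T := (f p.1, f p.2).

Lemma nth_eq_index u v : u < n -> (f u == v) = (u == index v s).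
Proof.
move=> un; have [vs|vs] := boolP (v \in s).
  by rewrite -{1}(nth_index x0 vs) nth_uniq ?index_mem.
rewrite (memNindex vs) (ltn_eqF un); apply: contraNF vs => /eqP <-.
exact: mem_nth.
Qed.

(** The recursion is [wdiffU1] and the cut is [wdiff_unbalanced]. A vertex outside [s] has index
    [size s], where both offsets read the default 0, so it is always balanced. *)
Lemma euler_count_wdiff L o i : uniq L -> {in L, forall p, p.1 < n /\ p.2 < n} ->
  size o = n -> size i = n ->
  wdiff [set x in map arc_of L] (fun v => nth 0 o (index v s)) (fun v => nth 0 i (index v s))
  = (Posz (euler_count L o i).1 - Posz (euler_count L o i).2)%R.
Proof.
elim: L o i => [|[u v] L IH] o i /=.
  move=> _ _ so si; rewrite (_ : [set _ in _] = set0); last by apply/setP=> y; rewrite !inE.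
  rewrite wdiff0; have [/eqP oi|oi] := boolP (o == i).
    by rewrite oi; case: forallP => // -[] v; rewrite eqxx.
  case: forallP => // H; case/eqP: oi; apply: (@eq_from_nth _ 0) => [|k]; rewrite so ?si // => kn.
  by have /eqP := H (f k); rewrite index_uniq.
move=> /andP[uvL uL] Ln so si.
have [un vn] : u < n /\ v < n by apply: (Ln (u, v)); rewrite inE eqxx.
have Ln' : {in L, forall p, p.1 < n /\ p.2 < n} by move=> p pL; apply: Ln; rewrite inE pL orbT.
have injA : {in (u, v) :: L &, injective arc_of}.
  move=> p q /Ln[p1 p2] /Ln[q1 q2] [/eqP E1 /eqP E2]; move: E1 E2; rewrite !nth_uniq //.
  by case: p {p1 p2} => a b; case: q {q1 q2} => c d /= /eqP -> /eqP ->.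
have fresh w : w < n -> ~~ touches w L ->
    forall p, p \in [set x in map arc_of L] -> p.1 != f w /\ p.2 != f w.
  move=> wn /hasPn H p; rewrite inE => /mapP[q qL ->] /=; have [q1 q2] := Ln' q qL.
  by have := H q qL; rewrite negb_or !nth_uniq // => /andP[].
have rec o' i' : size o' = n -> size i' = n ->
    wdiff [set x in map arc_of L] (fun v => nth 0 o' (index v s)) (fun v => nth 0 i' (index v s))
    = let ab := if (touches u L || (nth 0 o' u == nth 0 i' u))
         && (touches v L || (nth 0 o' v == nth 0 i' v))
         then euler_count L o' i' else (0, 0) in (Posz ab.1 - Posz ab.2)%R.
  move=> so' si'; case: ifP => [_|/negbT]; first exact: IH.
  rewrite negb_and !negb_or => /orP[]/andP[tw ow].
    by rewrite (@wdiff_unbalanced _ _ _ _ (f u)) ?subrr ?index_uniq //; apply: fresh.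
  by rewrite (@wdiff_unbalanced _ _ _ _ (f v)) ?subrr ?index_uniq //; apply: fresh.
rewrite (_ : [set x in _] = (f u, f v) |: [set x in map arc_of L]); last first.
  by apply/setP=> y; rewrite !inE.
rewrite wdiffU1; last first.
  rewrite inE; apply/mapP=> -[q qL /esym E]; case/negP: uvL.
  by rewrite -(injA q (u, v) _ _ E) ?inE ?qL ?eqxx ?orbT.
rewrite rec //.
have incE a w l : a < n -> nth 0 l (index w s) + (f a == w) = nth 0 (incr_nth l a) (index w s).
  by move=> an; rewrite nth_incr_nth addnC nth_eq_index.
rewrite (@eq_wdiff _ _ _ _ (fun w => nth 0 (incr_nth o u) (index w s))
   (fun w => nth 0 (incr_nth i v) (index w s))); last by move=> w /=; rewrite !incE.
rewrite rec ?size_incr_nth ?so ?si ?un ?vn //=.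
case: (if _ then _ else _) => a b; case: (if _ then _ else _) => c d /=.
by rewrite !PoszD opprB addrACA opprD; congr (_ + _)%R; rewrite addrC.
Qed.

Variable e : rel T.
Hypothesis e_sym : symmetric e.
Hypothesis e_irr : irreflexive e.

Definition adj : rel nat := fun i j => e (f i) (f j).

(** The successful check applies to this graph's own edge list. Since [phi] is proper and not
    rainbow, it refutes the rainbow outcome of [leaf]; the orientation that remains is carried over
    by the numbering. *)
Lemma small_AT (phi : nat -> nat) w : n \in [:: 4; 6; 8] -> w < n ->
  [seq count (adj v) (iota 0 n) | v <- iota 0 n] = degree_targets n w ->
  sorted_keys n adj ->
  (forall k, phi k < 3) -> (forall i j, i < n -> j < n -> adj i j -> phi i != phi j) ->
  ~~ uniq [:: phi 0; phi 1; phi 2] ->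
  AT_on e [set x in s] (fun v => if index v s < 3 then 2 else 3).
Proof.
move=> n468 wn degs srt phi3 prop nonrb.
have adj_sym : symmetric adj by move=> i j; rewrite /adj e_sym.
have adj_irr : irreflexive adj by move=> i; rewrite /adj e_irr.
have n3 : 3 < n by move: n468; rewrite !inE => /or3P[]/eqP ->.
have /allP/(_ w) := check_small n468; rewrite mem_iota wn => /(_ isT).
rewrite -degs -[[::]]/(edges_to n adj 0) => /(rows_sound adj_sym adj_irr (add0n n) srt).
set E := edges_to n adj n; rewrite /leaf.
have Emem u v : ((u, v) \in E) = [&& u < v < n & adj u v].
  rewrite edges_to_mem; case uv: (u < v < n); rewrite ?andbF //=.
  by case/andP: uv => uv vn; rewrite (ltn_trans uv vn).
case: ifP => [rb _|_].
  have := @rainbow_forced_sound phi E n 0; rewrite rb => H; case/negP: nonrb.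
  have -> : [:: phi 0; phi 1; phi 2] = take 3 [seq phi k | k <- iota 0 n].
    by case: (n) n3 => [|[|[|m]]] //= _; rewrite take0.
  apply: H => // -[u v]; rewrite Emem => /andP[/andP[uv vn]]; apply: prop => //.
  exact: ltn_trans uv vn.
have Elt : {in E, forall p, p.1 < p.2} by move=> [u v]; rewrite Emem => /andP[/andP[]].
case/find_orientation_sound=> // L [normL capL]; rewrite cats0 => /= neq.
have uL : uniq [seq norm p | p <- L] by rewrite normL rev_uniq edges_to_uniq.
have Ln : {in L, forall p, p.1 < n /\ p.2 < n}.
  move=> p pL; have : norm p \in E by rewrite -mem_rev -normL map_f.
  by rewrite Emem /= => /andP[/andP[_]]; rewrite gtn_max => /andP[].
have normE i j : i < j -> j < n -> adj i j = ((i, j) \in L) || ((j, i) \in L).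
  move=> ij jn; have := Emem i j; rewrite ij jn /= => <-.
  rewrite -mem_rev -normL; apply/mapP/orP=> [[[a b] abL]|].
    rewrite /norm /=; case: (leqP a b) => ab; rewrite ?(minn_idPl ab) ?(maxn_idPr ab)
      ?(minn_idPr (ltnW ab)) ?(maxn_idPl (ltnW ab)) => -[-> ->]; by [left|right].
  by case=> [H|H]; [exists (i, j)|exists (j, i)]; rewrite // /norm /=
     ?(minn_idPl (ltnW ij)) ?(maxn_idPr (ltnW ij)) ?(minn_idPr (ltnW ij)) ?(maxn_idPl (ltnW ij)).
have uL' : uniq L := map_uniq uL.
(* Each edge underlies exactly one arc of [L], so none is oriented both ways. *)
have injN : {in L &, injective norm}.
  move=> p q pL qL npq; have /eqP : index p L == index q L.
    rewrite -(nth_uniq (norm p) _ _ uL) ?size_map ?index_mem //.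
    by rewrite !(nth_map p) ?index_mem // !nth_index // npq.
  by move/(congr1 (nth p L)); rewrite !nth_index.
have asymL i j : i < j -> ~~ (((i, j) \in L) && ((j, i) \in L)).
  move=> ij; apply/negP=> /andP[H1 H2].
  have /(injN _ _ H1 H2)[ji _] : norm (i, j) = norm (j, i) by rewrite /norm /= minnC maxnC.
  by rewrite ji ltnn in ij.
pose d u v := (u, v) \in map arc_of L.
have dE i j : i < n -> j < n -> d (f i) (f j) = ((i, j) \in L).
  move=> ni nj; apply/mapP/idP=> [[[a b] abL [/eqP E1 /eqP E2]]|ijL]; last by exists (i, j).
  have [an bn] := Ln _ abL; move: E1 E2; rewrite !nth_uniq //.
  by move=> /eqP -> /eqP ->.
have dS u v : d u v -> u \in s /\ v \in s.
  by case/mapP=> p /Ln[p1 p2] [-> ->]; rewrite !mem_nth.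
have inS v : v \in s -> exists2 i, i < n & v = f i.
  by move=> vs; exists (index v s); rewrite ?index_mem ?nth_index.
exists d; split.
- move=> u v; rewrite /induced !inE.
  have [us|us] := boolP (u \in s); last first.
    rewrite andbF; have [/dS[]|_] := boolP (d u v); first by rewrite (negPf us).
    by have [/dS[_]|_] := boolP (d v u); first by rewrite (negPf us).
  have [vs|vs] := boolP (v \in s); last first.
    rewrite !andbF; have [/dS[_]|_] := boolP (d u v); first by rewrite (negPf vs).
    by have [/dS[]|_] := boolP (d v u); first by rewrite (negPf vs).
  rewrite !andbT; have [i ni ->] := inS u us; have [j nj ->] := inS v vs.
  rewrite !dE // -/(adj i j); case: (ltngtP i j) => ij.
  + by rewrite normE // asymL.
  + by rewrite adj_sym normE // orbC andbC asymL.
  + rewrite ij adj_irr orbb andbb; suff -> : ((j, j) \in L) = false by [].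
    apply/negP=> jL; have : norm (j, j) \in E by rewrite -mem_rev -normL map_f.
    by rewrite Emem /norm /= minnn maxnn ltnn.
- rewrite diffD_wdiff (_ : arcs d = [set x in map arc_of L]); last first.
    by apply/setP=> -[u v]; rewrite !inE.
  rewrite (@eq_wdiff _ _ _ _ (fun v => nth 0 (nseq n 0) (index v s))
    (fun v => nth 0 (nseq n 0) (index v s))); last by move=> v; rewrite addnC.
  rewrite euler_count_wdiff ?size_nseq // GRing.subr_eq0.
  by apply: contra neq => /eqP[->].
- move=> v; rewrite inE => vs; have [k nk ->] := inS v vs.
  have -> : (if index (f k) s < 3 then 2 else 3) = (nth 0 (1 :: 1 :: 1 :: nseq (n - 3) 2) k).+1.
    rewrite index_uniq //; case: k nk => [|[|[|k]]] //= nk.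
    by rewrite nth_nseq (_ : k < n - 3) // ltn_subRL.
  rewrite ltnS; apply: leq_trans (capL k); rewrite -size_filter.
  apply: leq_trans (_ : size [seq f p.2 | p <- [seq p <- L | p.1 == k]] <= _).
    apply: leq_trans (card_size _); apply: subset_leq_card; apply/subsetP=> y.
    rewrite inE => /mapP[p pL [/eqP fk ->]]; apply: map_f; rewrite mem_filter pL andbT.
    by rewrite eq_sym -(nth_uniq x0 _ _ s_uniq) ?(Ln p pL).1.
  by rewrite size_map.
Qed.
End Transfer.

(** * Degree counting *)

(** [D] is the degree sum, [F] the sum of [f], [K] the surplus and [p] the number of special
    vertices present. From [D = 3n - p + K] the density bound becomes [n + 5K < 5p]. With [n > 3]
    this leaves [p = 3, K = 1, n < 10], where [D = 3n - 2] is even only for even [n], and two cases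
    with [n = 4] ([p = 3, K = 2] and [p = 2, K = 1]), where [D = 11] is odd. *)
Lemma surplus_one (D F K n p m : nat) :
  D = 2 * m -> F + p = 3 * n -> D = F + K -> 0 < K -> 3 < n -> 5 * D < 14 * n -> p <= 3 ->
  [/\ p = 3, K = 1 & (n == 4) || (n == 6) || (n == 8)].
Proof. by move=> *; split; lia. Qed.

Section Specials.
Variable T : finType.
Variable e : rel T.
Hypothesis e_sym : symmetric e.
Hypothesis e_irr : irreflexive e.
Implicit Types (B S : {set T}).

(** Both sides count the incidences between vertices of [S] and edges inside [S]. *)
Lemma handshake S :
  \sum_(v in S) degS e S v = 2 * #|[set A in edges e | A \subset S]|.
Proof.
set F := [set A in edges e | A \subset S].
have FP A : reflect (exists u v, [/\ e u v, u \in S, v \in S & A = [set u; v]]) (A \in F).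
  rewrite !inE; apply: (iffP andP).
    case=> /existsP[u /existsP[v /andP[euv /eqP ->]]].
    by rewrite subUset !sub1set => /andP[uS vS]; exists u, v.
  case=> u [v [euv uS vS ->]]; rewrite subUset !sub1set uS vS; split=> //.
  by apply/existsP; exists u; apply/existsP; exists v; rewrite euv eqxx.
have degE v : v \in S -> degS e S v = \sum_(A in F) (v \in A).
  move=> vS; rewrite -big_mkcondr /=.
  rewrite /degS -(@card_in_imset _ _ (fun u => [set v; u])); last first.
    move=> u u'; rewrite !inE => /andP[_ evu] _ /setP/(_ u).
    rewrite !inE eqxx orbT; case: eqVneq evu => [->|_ _]; first by rewrite e_irr.
    by move=> /esym/eqP.
  rewrite -sum1_card; apply: eq_bigl => A.
  apply/imsetP/andP=> [[u]|[/FP[a [b [eab aS bS ->]]]]].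
    rewrite inE => /andP[uS evu] ->; split; last by rewrite !inE eqxx.
    by apply/FP; exists v, u.
  rewrite !inE => /orP[]/eqP ->; first by exists b; rewrite // inE bS.
  by exists a; rewrite ?inE ?aS 1?e_sym // setUC.
rewrite (eq_bigr _ degE) exchange_big /= mulnC -sum_nat_const; apply: eq_bigr => A.
case/FP=> a [b [eab aS bS ->]]; rewrite -big_mkcondr /=.
have -> : 2 = #|[set a; b]|.
  by rewrite cards2; case: eqVneq eab => // ->; rewrite e_irr.
rewrite -sum1_card; apply: eq_bigl => v; rewrite !inE.
by case: eqVneq => [->|_]; rewrite ?aS ?andbT //=; case: eqVneq => [->|]; rewrite ?bS ?andbF.
Qed.

Hypothesis mad : mad_lt e 14 5.

Lemma mad_degS S : S != set0 -> 5 * \sum_(v in S) degS e S v < 14 * #|S|.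
Proof.
move=> S0; rewrite handshake mulnC.
apply: (mad S0); first by apply/subsetP=> A; rewrite inE => /andP[].
by move=> A; rewrite inE => /andP[].
Qed.

(** A K4 has degree sum 12 on 4 vertices, and 5 times 12 exceeds 14 times 4. *)
Lemma mad_no_K4 S : ~ has_K4 e S.
Proof.
case=> s [us s4 _ K]; have s0 : [set v in s] != set0.
  by apply/set0Pn; case: s s4 {us K} => // a s _; exists a; rewrite !inE eqxx.
have cs : #|[set v in s]| = 4 by rewrite cardsE (card_uniqP us).
have := mad_degS s0; rewrite cs.
rewrite (eq_bigr (fun=> 3)) ?sum_nat_const ?cs // => v; rewrite inE => vs.
rewrite /degS (_ : [set u in _ | _] = [set v in s] :\ v).
  by have := cardsD1 v [set v in s]; rewrite cs inE vs => -[].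
apply/setP=> u; rewrite !inE andbC; case us' : (u \in s); rewrite ?andbF ?andbT //.
case: eqVneq => [->|uv]; first by rewrite e_irr.
by rewrite K // eq_sym.
Qed.

Lemma degS_card S v : v \in S -> degS e S v < #|S|.
Proof.
move=> vS; rewrite (cardsD1 v S) vS ltnS; apply: subset_leq_card; apply/subsetP=> u.
rewrite !inE => /andP[-> evu]; rewrite andbT.
by apply: contraTneq evu => ->; rewrite e_irr.
Qed.

(** * The induction over induced subgraphs *)

Variables x y z : T.
Hypotheses (xy : x != y) (yz : y != z) (xz : x != z).
Let P := [set x; y; z].
Let f v := if v \in P then 2 else 3.

Lemma card_specials : #|P| = 3.
Proof. by rewrite /P setUC cardsU1 cards2 !inE negb_or xy ![z == _]eq_sym xz yz. Qed.

Variable phi : T -> 'I_3.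
Hypothesis phi_proper : proper3 e phi.
Hypothesis phi_not_rainbow : #|phi @: P| != 3.

(** The triangle would be all of [P], and a proper colouring is injective on it, so [phi] would be
    rainbow. *)
Lemma specials_no_triangle u v w : uniq [:: u; v; w] -> [set u; v; w] \subset P ->
  e u v -> e v w -> e u w -> False.
Proof.
move=> un sub uv vw uw; case/eqP: phi_not_rainbow.
have sz : #|[set u; v; w]| = 3.
  have -> : [set u; v; w] = [set t in [:: u; v; w]] by apply/setP=> t; rewrite !inE orbA.
  by rewrite cardsE (card_uniqP un).
have -> : P = [set u; v; w] by apply/esym/eqP; rewrite eqEcard sub card_specials sz.
rewrite card_in_imset // => a b.
have N c d : e c d -> phi c = phi d -> c = d by move=> /phi_proper/eqP.
have N' c d : e d c -> phi c = phi d -> c = d by rewrite e_sym; apply: N.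
by rewrite !inE -!orbA => /or3P[]/eqP -> /or3P[]/eqP -> //; try exact: N; exact: N'.
Qed.

Lemma core_degree_AT S : S != set0 -> (forall v, v \in S -> degS e S v = f v) ->
  (forall S', #|S'| < #|S| -> AT_on e S' f) -> AT_on e S f.
Proof.
move=> S0 deg IH.
(* Even cycles have at most [#|T|] vertices, so their existence is decided by a bounded search. *)
have [/existsP[k /existsP[t evt]]|noev] :=
  boolP [exists k : 'I_#|T|.+1, [exists t : k.-tuple T, evenc e S t]]; last first.
  have [|||u [v [w [un sub uv vw uw]]]] :=
    @evenc_or_triangle _ e e_sym e_irr S P S0 (eq_leq card_specials).
  - by move=> v vS; rewrite deg // /f; case: ifP.
  - by move=> v vS vP; rewrite deg // /f (negPf vP).
  - move=> s evs; have sT : size s < #|T|.+1 by have /and5P[/card_uniqP <- _ _ _ _] := evs; rewrite ltnS max_card.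
    by case/negP: noev; apply/existsP; exists (Ordinal sT); apply/existsP; exists (in_tuple s).
  - by case: (specials_no_triangle un sub uv vw uw).
have [|B0 [BS B00 ATB]] := evenc_AT e_sym e_irr _ (@mad_no_K4 S) evt.
  by move=> v vS; rewrite deg // /f; case: ifP.
have [C [CS C0 ATC nb]] := AT_on_deg_closure e_sym e_irr BS B00 ATB.
(* No edge joins the closed set [C] to the rest, so the rest, which is smaller, is supplied by
   induction at no cost. *)
rewrite (_ : S = C :|: S :\: C); last first.
  by rewrite -[LHS](setID S C) (setIidPr CS).
apply: (@AT_onU _ e e_sym C (S :\: C) f f).
- by rewrite -setI_eq0 setIDA setIC setDIl setDv setI0.
- apply: AT_on_leq ATC _ => v vC; rewrite -deg ?(subsetP CS) //.
  by apply: subset_leq_card; apply/subsetP=> u; rewrite !inE => /andP[/(subsetP CS) -> ->].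
- apply: IH; rewrite -(cardsID C S) (setIidPr CS) -[X in X < _]add0n ltn_add2r card_gt0.
  exact: C0.
- move=> v vSC; rewrite /degS (_ : [set u in C | _] = set0) ?cards0 ?addn0 //.
  by apply/setP=> u; rewrite !inE; apply/negP=> /andP[uC]; apply/negP; exact: nb.
Qed.

(** The vertices are numbered with x, y, z in front and the others by decreasing key, which meets
    the symmetry breaking of the enumeration. *)
Lemma core_surplus_AT S w : P \subset S -> #|S| \in [:: 4; 6; 8] -> w \in S ->
  (forall v, v \in S -> degS e S v = f v + (v == w)) -> AT_on e S f.
Proof.
move=> PS n468 wS deg.
pose keyT v := (e x v).*2.*2 + (e y v).*2 + e z v.
pose r := sort (fun u v => geq (keyT u) (keyT v)) (enum (S :\: P)).
pose s := [:: x, y, z & r].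
have mem_r v : (v \in r) = (v \in S) && (v \notin P).
  by rewrite mem_sort mem_enum !inE andbC.
have mem_s v : (v \in s) = (v \in S).
  rewrite !(inE, mem_r) /P; have [vP|vP] := boolP (v \in P).
    rewrite (subsetP PS v vP) ; move: vP; rewrite !inE -!orbA => /or3P[]->; by rewrite ?orbT.
  by move: vP; rewrite !inE !negb_or => /andP[/andP[/negPf-> /negPf->] /negPf->]; rewrite andbT.
have us : uniq s.
  by rewrite /= !inE !negb_or xy xz yz !mem_r !inE !eqxx /= ?orbT /= !andbF sort_uniq enum_uniq.
have szs : size s = #|S| by rewrite -(card_uniqP us); apply: eq_card.
have index3 v : (index v s < 3) = (v \in P).
  rewrite /s /= !inE -!orbA ![v == _]eq_sym; case: eqP => //; case: eqP => //; by case: eqP.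
rewrite (_ : S = [set v in s]); last by apply/setP=> v; rewrite inE mem_s.
apply: (AT_on_leq (f := fun v => if index v s < 3 then 2 else 3)); last first.
  by move=> v _; rewrite index3.
have ws : index w s < size s by rewrite index_mem mem_s.
apply: (@small_AT _ x s us e e_sym e_irr (fun k => phi (nth x s k)) (index w s)) => //.
- by rewrite szs.
- apply: (@eq_from_nth _ 0) => [|k].
    have szl : size (2 :: 2 :: 2 :: nseq (size s - 3) 3) = size s.
      by rewrite /= size_nseq ?subSS ?subn0.
    by rewrite size_map size_iota size_incr_nth szl ws.
  rewrite size_map size_iota => kn; rewrite (nth_map 0) ?size_iota // nth_iota // add0n.
  rewrite /degree_targets nth_incr_nth.
  have -> : count (adj x s e k) (iota 0 (size s)) = degS e S (nth x s k).
    have -> : count (adj x s e k) (iota 0 (size s)) = count (e (nth x s k)) (map (nth x s) (iota 0 (size s))).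
      by rewrite count_map.
    rewrite map_nth_iota0 // take_size -size_filter -(card_uniqP (filter_uniq _ us)).
    by apply: eq_card => u; rewrite !inE mem_filter mem_s andbC.
  rewrite deg -?mem_s ?mem_nth // addnC; congr addn.
    by rewrite (nth_eq_index x us) // eq_sym.
  rewrite /f -index3 index_uniq //; case: k kn => [|[|[|k]]] //= kn.
  by rewrite nth_nseq (_ : k < _) // /s /= ?subSS ?subn0.
- rewrite /sorted_keys.
  have -> : [seq (adj x s e 0 v).*2.*2 + (adj x s e 1 v).*2 + adj x s e 2 v | v <- iota 3 (size s - 3)]
      = map keyT r.
    have -> : r = [seq nth x s v | v <- iota 3 (size s - 3)].
      by rewrite map_nth_iota /= ?drop0 ?subSS ?subn0 ?take_size.
    by rewrite -map_comp.
  rewrite sorted_map; apply: sort_sorted => u v; exact: leq_total.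
- by move=> i j _ _ /phi_proper.
- apply: contra phi_not_rainbow => un; rewrite /P !imsetU !imset_set1.
  have -> : [set phi x] :|: [set phi y] :|: [set phi z] = [set c in [:: phi x; phi y; phi z]].
    by apply/setP=> c; rewrite !inE orbA.
  rewrite cardsE (card_uniqP _) //.
Qed.

Lemma AT_on_specials S : AT_on e S f.
Proof.
have [k] := ubnP #|S|; elim: k S => // k IH0 S; rewrite ltnS => Sk.
have IH S' : #|S'| < #|S| -> AT_on e S' f by move=> lt; apply: IH0; apply: leq_trans lt Sk.
have [->|S0] := eqVneq S set0; first exact: AT_on0.
have [/existsP[v /andP[vS dv]]|/existsPn nlow] :=
  boolP [exists v, (v \in S) && (degS e S v < f v)].
  apply: (AT_on_rem e_sym e_irr vS dv); apply: IH.
  by rewrite [X in _ < X](cardsD1 v) vS.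
have low v : v \in S -> f v <= degS e S v.
  by move=> vS; have := nlow v; rewrite vS /= -leqNgt.
have sumf : \sum_(v in S) f v + #|S :&: P| = 3 * #|S|.
  rewrite -[#|S :&: P|]sum1_card.
  have -> : \sum_(v in S :&: P) 1 = \sum_(v in S) (v \in P).
    by rewrite -big_mkcondr /=; apply: eq_bigl => v; rewrite inE.
  rewrite -big_split /= mulnC -sum_nat_const; apply: eq_bigr => v _.
  by rewrite /f; case: ifP.
pose D := \sum_(v in S) degS e S v.
have DE : D = \sum_(v in S) f v + \sum_(v in S) (degS e S v - f v).
  by rewrite -big_split /=; apply: eq_bigr => v vS; rewrite subnKC ?low.
have [K0|K0] := posnP (\sum_(v in S) (degS e S v - f v)).
  apply: core_degree_AT => // v vS; apply/eqP; rewrite eqn_leq low // andbT -subn_eq0.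
  by move/eqP: K0; rewrite sum_nat_eq0 => /forallP/(_ v); rewrite vS.
(* A vertex outside [P] has at least three neighbours in [S]. If there is none, then [S] has at most
   three vertices, so degrees are at most 2 and no surplus is possible. *)
have n4 : 3 < #|S|.
  have [/subsetP SP|/subsetPn[v vS vP]] := boolP (S \subset P); last first.
    by apply: leq_trans (degS_card vS); rewrite ltnS; have := low v vS; rewrite /f (negPf vP).
  have S3 : #|S| <= 3 by rewrite -card_specials; apply/subset_leq_card/subsetP.
  case/eqP: (lt0n_neq0 K0); apply: big1 => v vS; apply/eqP; rewrite subn_eq0 /f SP //.
  by rewrite -ltnS; apply: leq_trans (degS_card vS) S3.
have madS : 5 * D < 14 * #|S| := mad_degS S0.
have SP3 : #|S :&: P| <= 3 by rewrite -card_specials subset_leq_card ?subsetIr.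
have [SP K1 n468] : [/\ #|S :&: P| = 3, \sum_(v in S) (degS e S v - f v) = 1 &
                       (#|S| == 4) || (#|S| == 6) || (#|S| == 8)].
  exact: surplus_one (handshake S) sumf DE K0 n4 madS SP3.
have PS : P \subset S.
  by apply/setIidPr/eqP; rewrite eqEcard subsetIr card_specials SP.
case/eqP/sum_nat_eq1: K1 => w [wS fw others].
apply: (core_surplus_AT PS _ wS) => [|v vS]; first by rewrite !inE orbA.
have [->|vw] := eqVneq v w; first by rewrite -[nat_of_bool true]fw subnKC ?low.
by rewrite addn0; apply/eqP; rewrite eqn_leq low // andbT -subn_eq0 others.
Qed.

End Specials.

Theorem mainTheorem6 (T : finType) (e : rel T)
  (e_sym : symmetric e) (e_irr : irreflexive e) :
  mad_lt e 14 5 ->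
  forall x y z : T, x != y -> y != z -> x != z ->
  ~ blocked e x y z ->
  AT_extendable e [:: x; y; z] [:: 2; 2; 2].
Proof.
move=> mad x y z xy yz xz nblocked.
(* Colourings are taken as finite functions so that a non-rainbow one can be searched for; if none
   exists, the triple is blocked by the rainbow clause. *)
pose Q (phi : {ffun T -> 'I_3}) := [forall u, forall v, e u v ==> (phi u != phi v)].
have [phi phi_proper nrb] : exists2 phi, proper3 e phi & #|phi @: [set x; y; z]| != 3.
  have [/existsP[phi /andP[/forallP Qphi nrb]]|/existsPn H] :=
    boolP [exists phi, Q phi && (#|phi @: [set x; y; z]| != 3)].
    by exists phi => // u v euv; have /forallP/(_ v)/implyP := Qphi u; apply.
  case: nblocked; left=> phi phi_proper.
  have := H (finfun phi); rewrite negb_and negbK => /orP[/negP[]|/eqP c3].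
    apply/forallP=> u; apply/forallP=> v; apply/implyP=> euv.
    by rewrite !ffunE phi_proper.
  by rewrite -[RHS]c3; congr #|pred_of_set _|; apply: eq_imset => u; rewrite ffunE.
have [d [od nz df]] := AT_on_specials e_sym e_irr mad xy yz xz phi_proper nrb [set: T].
exists d; split=> //.
  by move=> u v; rewrite -(od u v).1 /induced !inE !andbT; split=> //; exact: (od u v).2.
move=> v; have := df v (in_setT v).
rewrite (_ : (v \in [set x; y; z]) = (v \in [:: x; y; z])); last by rewrite !inE orbA.
case: ifP => //; rewrite -index_mem.
by case: (index v _) => [|[|[|]]].
Qed.
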